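(* Let $v_\infty,v_0\in\mathcal{L}$ with $(v_0,v_\infty)=-1$, and let $(\Lambda^{c},\eta^{c})$ be a Christoffel transform, with respect to $(v_\infty,v_0)$, of an isothermic surface $(\Lambda,\eta)$ in $S^n$. If $(\Lambda,\eta)$ is a special isothermic surface of type $d\in\mathbb{N}_{0}$ with respect to a polynomial $p(t)$ for which the constant term $p(0)\in\langle v_{\infty}\rangle^{\perp}$, then $(\Lambda^{c},\eta^{c})$ is a special isothermic surface of type $d$, with respect to a polynomial $q(t)$ such that $(q(t),q(t))=(p(t),p(t))$ and $q(0)\in\langle v_{0}\rangle^{\perp}$. Moreover, if $p(0)\in\langle v_{\infty}\rangle$, then $q(0)\in\langle v_{0}\rangle$.
   Context: Let $n\ge 3$. $\mathbb{R}^{n+1,1}$ denotes $\mathbb{R}^{n+2}$ with an inner product $(\cdot,\cdot)$ of signature $(n+1,1)$, $\mathcal{L}$ its light-cone, and $S^n\cong\mathbb{P}(\mathcal{L})$. $\Sigma$ is a connected smooth surface, $\underline{\mathbb{R}}^{n+1,1}=\Sigma\times\mathbb{R}^{n+1,1}$, and $\mathrm{d}$ is its trivial flat connection. A map $\Sigma\to S^n$ is identified with a null line subbundle $\Lambda\subset\underline{\mathbb{R}}^{n+1,1}$; a lift of $\Lambda$ is a never-vanishing section $F$; $\Lambda$ is an immersion iff $\langle F,\mathrm{d}F(T\Sigma)\rangle$ is a subbundle of rank $3$. Identify $\bigwedge^2\mathbb{R}^{n+1,1}$ with $\mathrm{o}(\mathbb{R}^{n+1,1})$ by $(u\wedge v)w=(u,w)v-(v,w)u$.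 An isothermic surface $(\Lambda,\eta)$ in $S^n$ is an immersion $\Lambda$ with a non-zero closed $1$-form $\eta\in\Omega^1\otimes\mathrm{o}(\mathbb{R}^{n+1,1})$ taking values in $\Lambda\wedge\Lambda^{\perp}$. A polynomial conserved quantity of $(\Lambda,\eta)$ is a non-zero polynomial $p(t)=\sum_k p_kt^k$ with $p_k\in\Gamma(\underline{\mathbb{R}}^{n+1,1})$ such that $(\mathrm{d}+t\eta)p(t)=0$ for all $t\in\mathbb{R}$. $(\Lambda,\eta)$ is special isothermic of type $d$ with respect to $p(t)$ if $p(t)$ is a polynomial conserved quantity of degree $d$. Christoffel transforms: put $\mathbb{R}^n=\langle v_0,v_\infty\rangle^\perp$. Suppose $\Lambda$ has a lift $F=\exp(f\wedge v_\infty)v_0=v_0+f+\frac12(f,f)v_\infty$ with $f:\Sigma\to\mathbb{R}^n$ (i.e. $(F,v_\infty)=-1$). Write $\eta=\mathrm{Ad}(\exp(f\wedge v_\infty))\,\omega$, with $\omega$ a $1$-form with values in $\langle v_0\rangle\wedge\langle v_0\rangle^\perp$; then $\omega$ is closed and, locally (shrinking $\Sigma$ if necessary), $\omega=\mathrm{d}f^c\wedge v_0$ for a map $f^c:\Sigma\to\mathbb{R}^n$, unique up to translation and assumed to be an immersion. The Christoffel transforms of $(\Lambda,\eta)$ with respect to $(v_\infty,v_0)$ are the isothermic surfaces $(\Lambda^c:=\langle F^c\rangle,\eta^c)$ with $F^c=\exp(f^c\wedge v_0)v_\infty$ and $\eta^c=\mathrm{Ad}(\exp(f^c\wedge v_0))(\mathrm{d}f\wedge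 v_\infty)$. (It is known that $\Gamma^c(t)\circ(\mathrm{d}+t\eta)\circ\Gamma^c(t)^{-1}=\mathrm{d}+t\eta^c$ for $t\neq 0$, where $\Gamma^c(t)=\exp(f^c\wedge v_0)\circ\Gamma(t)\circ\exp(-f\wedge v_\infty)$ and $\Gamma(t)$ is $t$ on $v_\infty$, $1$ on $\mathbb{R}^n$, $t^{-1}$ on $v_0$.) *)

(* Defs.v *)
From HB Require Import structures.
From mathcomp Require Import all_boot all_order all_algebra.
From mathcomp Require Import all_classical all_reals all_analysis.

Set Implicit Arguments.
Unset Strict Implicit.
Unset Printing Implicit Defensive.

Import Order.TTheory GRing.Theory Num.Theory.
Import numFieldNormedType.Exports.
Local Open Scope classical_set_scope.
Local Open Scope ring_scope.

(* [D] is meant to be open, as the differential is the two-sided one. *)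
Fixpoint Ck_on (R : realType) (V : normedModType R) (k : nat)
    (D : set 'rV[R]_2) (g : 'rV[R]_2 -> V) : Prop :=
  if k is k'.+1 then
    (forall y, D y -> differentiable g y) /\
    (forall v, Ck_on k' D (fun y => 'd g y v))
  else forall y, D y -> {for y, continuous g}.

Definition Coo_on (R : realType) (V : normedModType R)
    (D : set 'rV[R]_2) (g : 'rV[R]_2 -> V) : Prop :=
  forall k, Ck_on k D g.

(* The coordinate map [coords i] and its inverse [param i] are total functions,
   only meaningful on [dom i] and on [coords i @` dom i] respectively. *)
Record smoothSurface (R : realType) := SmoothSurface {
  carrier :> topologicalType ;
  surface_hausdorff : hausdorff_space carrier ;
  surface_countable : @second_countable carrier ;
  chart : Type ;
  dom : chart -> set carrier ;
  coords : chart -> carrier -> 'rV[R]_2 ;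
  param : chart -> 'rV[R]_2 -> carrier ;
  dom_open : forall i, open (dom i) ;
  dom_cover : forall x, exists i, dom i x ;
  coord_open : forall i, open (coords i @` dom i) ;
  coordK : forall i x, dom i x -> param i (coords i x) = x ;
  coord_continuous : forall i, {within dom i, continuous (coords i)} ;
  param_continuous : forall i, {within coords i @` dom i, continuous (param i)} ;
  transition_smooth : forall i j,
    Coo_on (coords i @` (dom i `&` dom j)) (coords j \o param i) }.

Definition smooth_on (R : realType) (S : smoothSurface R) (V : normedModType R)
    (U : set S) (g : S -> V) : Prop :=
  forall i : chart S, Coo_on (coords i @` (U `&` dom i)) (g \o param i).

Definition smooth (R : realType) (S : smoothSurface R) (V : normedModType R)
    (g : S -> V) : Prop :=
  smooth_on setT g.

(* [a i x v] is the value of the form [a] at [x] on the tangent vector whose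
   components in the chart [i] are [v]; it is meaningful only for [dom i x]. *)
Definition vform (R : realType) (S : smoothSurface R) (V : Type) :=
  chart S -> S -> 'rV[R]_2 -> V.

Definition eq_form (R : realType) (S : smoothSurface R) (V : Type)
    (a b : vform S V) : Prop :=
  forall (i : chart S) (x : S) (v : 'rV[R]_2), dom i x -> a i x v = b i x v.

(* The second clause is the change of charts: the tangent vector with components
   [v] in the chart [i] has components ['d (coords j \o param i) (coords i x) v]
   in the chart [j]. *)
Definition smooth_1form (R : realType) (S : smoothSurface R)
    (V : normedModType R) (a : vform S V) : Prop :=
  [/\ forall (i : chart S) x, dom i x ->
        forall (c : R) v w, a i x (c *: v + w) = c *: a i x v + a i x w,
      forall (i j : chart S) x v, dom i x -> dom j x ->
        a i x v = a j x ('d (coords j \o param i) (coords i x) v)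
    & forall (i : chart S) v,
        Coo_on (coords i @` dom i) (fun y => a i (param i y) v)].

Definition dfun (R : realType) (S : smoothSurface R) (V : normedModType R)
    (g : S -> V) : vform S V :=
  fun i x v => 'd (g \o param i) (coords i x) v.

(* The exterior derivative of a 1-form, evaluated on the constant-coefficient
   (hence commuting) vector fields [v] and [w] of the chart [i]. *)
Definition dform (R : realType) (S : smoothSurface R) (V : normedModType R)
    (a : vform S V) (i : chart S) (x : S) (v w : 'rV[R]_2) : V :=
  'd (fun y => a i (param i y) w) (coords i x) v -
  'd (fun y => a i (param i y) v) (coords i x) w.

Definition closed_1form (R : realType) (S : smoothSurface R)
    (V : normedModType R) (a : vform S V) : Prop :=
  forall (i : chart S) x v w, dom i x -> dform a i x v w = 0.

Definition immersion (R : realType) (S : smoothSurface R) (V : normedModType R)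
    (g : S -> V) : Prop :=
  smooth g /\ forall (i : chart S) x, dom i x -> injective (dfun g i x).

(* [G] is the Gram matrix of the inner product of R^{n+1,1}, whose elements are
   column vectors. *)
Definition lorentzian (R : realType) (n : nat) (G : 'M[R]_n.+2) : Prop :=
  exists2 P : 'M[R]_n.+2, P \in unitmx
    & G = P^T *m diag_mx (\row_i (if i == ord_max then -1 else 1)) *m P.

Definition ip (R : realType) (n : nat) (G : 'M[R]_n.+2) (u w : 'cV[R]_n.+2) : R :=
  (u^T *m G *m w) 0 0.

Definition lightcone (R : realType) (n : nat) (G : 'M[R]_n.+2) :
    set 'cV[R]_n.+2 :=
  [set u | u != 0 /\ ip G u u = 0].

Definition orth (R : realType) (n : nat) (G : 'M[R]_n.+2)
    (A : set 'cV[R]_n.+2) : set 'cV[R]_n.+2 :=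
  [set w | forall u, A u -> ip G u w = 0].

Definition o_alg (R : realType) (n : nat) (G : 'M[R]_n.+2) : set 'M[R]_n.+2 :=
  [set A | forall u w, ip G (A *m u) w + ip G u (A *m w) = 0].

(* The endomorphism w |-> (u, w) v - (v, w) u. *)
Definition wedge (R : realType) (n : nat) (G : 'M[R]_n.+2)
    (u v : 'cV[R]_n.+2) : 'M[R]_n.+2 :=
  v *m (u^T *m G) - u *m (v^T *m G).

(* For subspaces [A] and [B], this is already closed under scaling. *)
Definition wedge_span (R : realType) (n : nat) (G : 'M[R]_n.+2)
    (A B : set 'cV[R]_n.+2) : set 'M[R]_n.+2 :=
  [set M | exists m (u w : 'I_m -> 'cV[R]_n.+2),
     [/\ forall k, A (u k), forall k, B (w k)
       & M = \sum_k wedge G (u k) (w k)]].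

Definition mexp (R : realType) (n : nat) (A : 'M[R]_n.+2) : 'M[R]_n.+2 :=
  limn (series (fun k => (k`!%:R)^-1 *: A ^+ k)).

Definition Ad (R : realType) (n : nat) (g A : 'M[R]_n.+2) : 'M[R]_n.+2 :=
  g *m A *m invmx g.

Definition lift_on (R : realType) (S : smoothSurface R) (n : nat)
    (L : S -> {vspace 'cV[R]_n.+2}) (U : set S) (F : S -> 'cV[R]_n.+2) : Prop :=
  smooth_on U F /\ forall x, U x -> F x \in L x /\ F x != 0.

Definition null_line_bundle (R : realType) (S : smoothSurface R) (n : nat)
    (G : 'M[R]_n.+2) (L : S -> {vspace 'cV[R]_n.+2}) : Prop :=
  [/\ forall x, \dim (L x) = 1%N,
      forall x u, u \in L x -> ip G u u = 0
    & forall x, exists U F, [/\ open U, U x & lift_on L U F]].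

Definition line_immersion (R : realType) (S : smoothSurface R) (n : nat)
    (L : S -> {vspace 'cV[R]_n.+2}) : Prop :=
  forall (U : set S) (F : S -> 'cV[R]_n.+2), open U -> lift_on L U F ->
  forall (i : chart S) x, U x -> dom i x ->
    \dim <<[:: F x; dfun F i x (delta_mx 0 0); dfun F i x (delta_mx 0 1)]>> = 3%N.

Definition isothermic (R : realType) (S : smoothSurface R) (n : nat)
    (G : 'M[R]_n.+2) (L : S -> {vspace 'cV[R]_n.+2})
    (eta : vform S 'M[R]_n.+2) : Prop :=
  [/\ null_line_bundle G L /\ line_immersion L,
      smooth_1form eta /\ closed_1form eta,
      exists (i : chart S) x v, dom i x /\ eta i x v <> 0
    & forall (i : chart S) x v, dom i x ->
        o_alg G (eta i x v) /\
        wedge_span G [set` L x] (orth G [set` L x]) (eta i x v)].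

(* A polynomial with sections as coefficients is given by the list of its
   coefficients, in increasing degrees; trailing zeros are allowed. *)
Definition polysec (R : realType) (S : smoothSurface R) (n : nat) :=
  seq (S -> 'cV[R]_n.+2).

Definition pcoef (R : realType) (S : smoothSurface R) (n : nat)
    (p : polysec S n) (k : nat) : S -> 'cV[R]_n.+2 :=
  nth (fun=> 0) p k.

Definition peval (R : realType) (S : smoothSurface R) (n : nat)
    (p : polysec S n) (t : R) : S -> 'cV[R]_n.+2 :=
  fun x => \sum_(k < size p) t ^+ k *: pcoef p k x.

Definition has_degree (R : realType) (S : smoothSurface R) (n : nat)
    (p : polysec S n) (d : nat) : Prop :=
  (exists x, pcoef p d x <> 0) /\
  (forall k, (d < k)%N -> forall x, pcoef p k x = 0).

Definition polynomial_conserved_quantity (R : realType) (S : smoothSurface R)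
    (n : nat) (eta : vform S 'M[R]_n.+2) (p : polysec S n) : Prop :=
  [/\ exists k x, pcoef p k x <> 0,
      forall k, smooth (pcoef p k)
    & forall (t : R) (i : chart S) x v, dom i x ->
        dfun (peval p t) i x v + t *: (eta i x v *m peval p t x) = 0].

Definition special_isothermic (R : realType) (S : smoothSurface R) (n : nat)
    (G : 'M[R]_n.+2) (L : S -> {vspace 'cV[R]_n.+2})
    (eta : vform S 'M[R]_n.+2) (d : nat) (p : polysec S n) : Prop :=
  [/\ isothermic G L eta, polynomial_conserved_quantity eta p & has_degree p d].

(* The 1-form omega is [dfun fc /\ v0].  The functions [f] and [fc] are defined
   on the whole of [S], which is to be thought of as already shrunk. *)
Definition christoffel_transform (R : realType) (S : smoothSurface R) (n : nat)
    (G : 'M[R]_n.+2) (vinf v0 : 'cV[R]_n.+2)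
    (L : S -> {vspace 'cV[R]_n.+2}) (eta : vform S 'M[R]_n.+2)
    (Lc : S -> {vspace 'cV[R]_n.+2}) (etac : vform S 'M[R]_n.+2) : Prop :=
  exists f fc : S -> 'cV[R]_n.+2,
  let Rn := orth G [set` <<[:: v0; vinf]>>%VS] in
  [/\ smooth f /\ (forall x, Rn (f x)),
      immersion fc /\ (forall x, Rn (fc x)),
      (forall x, L x = <[mexp (wedge G (f x) vinf) *m v0]>%VS) /\
      eq_form eta (fun i x v =>
        Ad (mexp (wedge G (f x) vinf)) (wedge G (dfun fc i x v) v0)),
      forall x, Lc x = <[mexp (wedge G (fc x) v0) *m vinf]>%VS
    & eq_form etac (fun i x v =>
        Ad (mexp (wedge G (fc x) v0)) (wedge G (dfun f i x v) vinf))].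

(* Main.v *)
From HB Require Import structures.
Require Import Defs.
From mathcomp Require Import all_boot all_order all_algebra.
From mathcomp Require Import all_classical all_reals all_analysis.
From mathcomp Require Import ring lra.
Import Order.TTheory GRing.Theory Num.Theory.
Import numFieldNormedType.Exports.
Local Open Scope classical_set_scope.
Local Open Scope ring_scope.

(** Write [e], [o] for [vinf], [v0], and [h] for the Christoffel transform [fc] of
    [f].  The lift of the surface is exp(f ^ e) o, where exp(f ^ e) is the null
    rotation fixing [e] and translating by f.  In the moving frame so obtained, the
    coefficients of a polynomial p(t) decompose as

      exp(-f ^ e) p_k = a_k o + w_k + b_k e,   w_k orthogonal to e and o,

    and, since the form of the surface is Ad(exp(f ^ e)) (dh ^ o), the condition
    (d + t eta) p(t) = 0 is equivalent to the system

      da_k = - (dh, w_(k-1)),  dw_k = - a_k df - b_(k-1) dh,  db_k = - (df, w_k).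

    This system is invariant under the exchange of [f] with [h], of [e] with [o],
    and of a_k with b_(k-1).  Hence

      q_k = exp(h ^ o) (a_(k+1) o + w_k + b_(k-1) e)

    solves the corresponding system for the transform ([dual_parallel]), provided
    that no term of degree -1 is lost, that is a_0 = - (p(0), e) = 0.  The values
    at t = 0 are read off directly, and the norm is preserved because it depends on
    the outer components only through the product a b ([dual_norm]).

    The degree is governed by the equation for w_k: in degree d + 1 it says
    b_d dh = 0, so that q has degree at most d as [h] is immersed; were q_d zero,
    the same equation in degree d would give a_d df = 0 and then p_d = 0, as [f] is
    immersed ([dual_degree]).

    It remains to see that the transform is isothermic.  Up to conjugation by the
    rotation, the exterior derivative of the form on tangent vectors v, w is

      ((df v, dh w) - (df w, dh v)) e ^ o + (dh w ^ df v - dh v ^ df w),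

    by symmetry of second differentials ([dform_chr_form], [dfun_sym]); its
    vanishing is a condition symmetric in [f] and [h] ([closed_chr_formP]).
    The immersion property passes between a map into the orthogonal complement of
    [e] and [o] and the null line bundle that it spans ([cone_lift_immersion],
    [immersion_of_cone_lift]). *)

Set Implicit Arguments.
Unset Strict Implicit.
Unset Printing Implicit Defensive.

(** * Differentials and smooth maps of the plane *)

Section Differentials.
Context {R : realType}.
Implicit Types U V W : normedModType R.

(** The differential is a germ invariant.  This is what lets one replace a map
    given through a chart and its inverse by an explicit formula valid only on
    the open coordinate domain. *)
Lemma near_diff U V (g h : U -> V) (x : U) :
  (\forall y \near x, g y = h y) -> differentiable g x ->
  differentiable h x /\ forall v, 'd h x v = 'd g x v.
Proof.
move=> gh dg.
have E : h \o shift x = cst (h x) + 'd g x +o_ 0 id.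
  pose r y := h (y + x) - g (y + x).
  have hg0 : r =o_ 0 (id : U -> U).
    apply/eqoP => e e0; near=> y.
    suff -> : r y = 0 by rewrite normr0 mulr_ge0// ltW.
    apply/eqP; rewrite subr_eq0 eq_sym; apply/eqP; near: y.
    by move/nbhs0P : gh; under eq_near do rewrite addrC.
  apply/eqaddoE; rewrite funeqE => y /=.
  have -> : h (y + x) = r y + g (y + x).
    by rewrite /r subrK.
  rewrite hg0 (diff_locallyx dg) -(nbhs_singleton gh) [LHS]addrC -addrA.
  by rewrite addox.
have D := diff_unique (diff_continuous dg) E.
split=> [|v]; last by rewrite D.
apply/diff_locallyP; rewrite D; split; last exact: E.
exact: (diff_continuous dg).
Unshelve. all: by end_near. Qed.

Lemma diff_add U V (g h : U -> V) (x v : U) :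
  differentiable g x -> differentiable h x ->
  differentiable (fun y => g y + h y) x /\
  'd (fun y => g y + h y) x v = 'd g x v + 'd h x v.
Proof.
move=> dg dh; split; first exact: differentiableD.
exact: (congr1 (fun F : U -> V => F v) (diffD dg dh)).
Qed.

Lemma diff_bilinear U V1 V2 W (B : {bilinear V1 -> V2 -> W})
    (g : U -> V1) (h : U -> V2) (x v : U) :
  continuous (fun p => B p.1 p.2) ->
  differentiable g x -> differentiable h x ->
  differentiable (fun y => B (g y) (h y)) x /\
  'd (fun y => B (g y) (h y)) x v = B ('d g x v) (h x) + B (g x) ('d h x v).
Proof.
move=> Bc dg dh.
pose P y := (g y, h y); pose Q p := B p.1 p.2.
have dP : differentiable P x by exact: differentiable_pair.
have dQ : differentiable Q (P x) by exact: differentiable_bilin.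
have -> : (fun y => B (g y) (h y)) = Q \o P by [].
split; first exact: differentiable_comp.
rewrite (diff_comp dP dQ) /= /Q diff_bilin // (diff_pair dg dh) /=.
by rewrite addrC.
Qed.

Lemma continuous_near_eq (T U : topologicalType) (g h : T -> U) (x : T) :
  (\forall y \near x, g y = h y) -> {for x, continuous g} ->
  {for x, continuous h}.
Proof.
move=> gh cg; rewrite /prop_for /continuous_at -(nbhs_singleton gh).
exact: cvg_trans (near_eq_cvg gh) cg.
Qed.

End Differentials.

Section Smooth_maps_of_the_plane.
Context {R : realType}.
Implicit Types U V W : normedModType R.
Implicit Types D : set 'rV[R]_2.

Lemma open_near D (P : 'rV[R]_2 -> Prop) (y : 'rV[R]_2) :
  open D -> D y -> (forall z, D z -> P z) -> \forall z \near y, P z.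
Proof. by move=> oD Dy DP; apply: filterS DP _; exact: open_nbhs_nbhs. Qed.

Lemma Ck_congr V (k : nat) D (g h : 'rV[R]_2 -> V) : open D ->
  (forall y, D y -> g y = h y) -> Ck_on k D g -> Ck_on k D h.
Proof.
move=> oD; elim: k g h => [|k IH] g h gh /=.
  by move=> cg y Dy; apply: continuous_near_eq (cg y Dy); exact: open_near gh.
have ghn y : D y -> \forall z \near y, g z = h z by move=> Dy; exact: open_near gh.
move=> [dg Cg]; split=> [y Dy|v]; first by have [] := near_diff (ghn y Dy) (dg y Dy).
apply: IH (Cg v) => y Dy.
by have [_ /(_ v)/esym] := near_diff (ghn y Dy) (dg y Dy).
Qed.

Lemma Ck_pred V (k : nat) D (g : 'rV[R]_2 -> V) : Ck_on k.+1 D g -> Ck_on k D g.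
Proof.
elim: k g => [|k IH] g [dg Cg] /=; first by move=> y /dg/differentiable_continuous.
by split=> // v; apply: IH.
Qed.

Lemma Ck_cst V (k : nat) D (c : V) : Ck_on k D (fun=> c).
Proof.
elim: k c => [|k IH] c /=; first by move=> y _; exact: cst_continuous.
split=> [y _|v]; first exact: differentiable_cst.
suff -> : (fun y : 'rV[R]_2 => 'd (fun=> c) y v) = fun=> 0 by exact: IH.
by apply/funext => y; have -> := diff_cst c y.
Qed.

Lemma Ck_add V (k : nat) D (g h : 'rV[R]_2 -> V) : open D ->
  Ck_on k D g -> Ck_on k D h -> Ck_on k D (fun y => g y + h y).
Proof.
move=> oD; elim: k g h => [|k IH] g h /=.
  by move=> cg ch y Dy; exact: (cvgD (cg y Dy) (ch y Dy)).
move=> [dg Cg] [dh Ch]; have dgh y v (Dy : D y) := diff_add v (dg y Dy) (dh y Dy).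
split=> [y Dy|v]; first by have [] := dgh y 0 Dy.
apply: Ck_congr oD _ (IH _ _ (Cg v) (Ch v)) => y Dy.
by have [] := dgh y v Dy.
Qed.

(** Induction on the order: the Leibniz rule writes the differential as a sum of
    two terms of the same shape, so the claim for all pairs of maps is needed at
    once, and only openness of the domain lets the formula be differentiated
    again. *)
Lemma Ck_bilin U V W (B : {bilinear U -> V -> W}) (k : nat) D
    (g : 'rV[R]_2 -> U) (h : 'rV[R]_2 -> V) :
  continuous (fun p => B p.1 p.2) -> open D ->
  Ck_on k D g -> Ck_on k D h -> Ck_on k D (fun y => B (g y) (h y)).
Proof.
move=> cB oD; elim: k g h => [|k IH] g h.
  move=> cg ch y Dy.
  apply: (@continuous_comp _ _ _ (fun z => (g z, h z)) (fun p => B p.1 p.2)).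
    exact: (cvg_pair (cg y Dy) (ch y Dy)).
  exact: cB.
move=> CSg CSh; have Cg := Ck_pred CSg; have Ch := Ck_pred CSh.
move: CSg CSh => [dg Cdg] [dh Cdh].
have dgh y v (Dy : D y) := diff_bilinear v cB (dg y Dy) (dh y Dy).
split=> [y Dy|v]; first by have [] := dgh y 0 Dy.
apply: (@Ck_congr _ _ _
  (fun y => B ('d g y v) (h y) + B (g y) ('d h y v)) _ oD) => [y Dy|].
  by have [] := dgh y v Dy.
exact: (Ck_add oD (IH _ _ (Cdg v) Ch) (IH _ _ Cg (Cdh v))).
Qed.

Lemma Coo_differential V D (g : 'rV[R]_2 -> V) (v : 'rV[R]_2) :
  Coo_on D g -> Coo_on D (fun y => 'd g y v).
Proof. by move=> Cg k; have [_ Cdg] := Cg k.+1; exact: Cdg. Qed.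

Lemma Coo_differentiable V D (g : 'rV[R]_2 -> V) y :
  Coo_on D g -> D y -> differentiable g y.
Proof. by move=> Cg Dy; have [dg _] := Cg 1%N; exact: dg. Qed.

End Smooth_maps_of_the_plane.

(** * Symmetry of second differentials *)

Section Schwarz.
Context {R : realType}.

Lemma is_derive_along (U V : normedModType R) (h : U -> V) (y v : U) (t : R) :
  differentiable h (y + t *: v) ->
  is_derive t 1 (fun s => h (y + s *: v)) ('d h (y + t *: v) v).
Proof.
move=> dh; pose P (s : R) := y + s *: v.
have dP : differentiable P t.
  apply: (@differentiableD _ _ _ (cst y)); first exact: differentiable_cst.
  exact: differentiableZl.
have D : differentiable (h \o P) t by exact: differentiable_comp.
apply: DeriveDef; first exact: diff_derivable D.
rewrite deriveE // (diff_comp dP dh) /=; congr ('d h _ _).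
have dv : differentiable ( *:%R^~ v : R -> U) t by exact: differentiableZl.
have [_ ->] := @diff_add R R U (cst y) _ t 1 (differentiable_cst y t) dv.
by rewrite (diff_cst y t) diff_val add0r scale1r.
Qed.

(* second difference via two mean values *)
(** The mean value theorem along [v], then along [w], turns the second difference
    over a small parallelogram into one second differential at an interior point.
    The left-hand side is symmetric in [v] and [w], which is the whole reason for
    the symmetry of second differentials. *)
Lemma second_difference (D : set 'rV[R]_2) (h : 'rV[R]_2 -> R) (y v w : 'rV[R]_2)
    (s : R) : 0 < s -> 
  (forall z, D z -> differentiable h z) ->
  (forall z, D z -> differentiable (fun z => 'd h z v) z) ->
  (forall a b, 0 <= a <= s -> 0 <= b <= s -> D (y + a *: v + b *: w)) ->
  exists a b, [/\ 0 <= a <= s, 0 <= b <= s &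
   h (y + s *: v + s *: w) - h (y + s *: v) - (h (y + s *: w) - h y) =
   s ^+ 2 * 'd (fun z => 'd h z v) (y + a *: v + b *: w) w].
Proof.
move=> s0 dh ddh Dab.
have ss : 0 <= s <= s by rewrite ltW //=.
have s00 : (0 : R) <= (0 : R) <= s by rewrite lexx ltW.
pose k (t : R) := h (y + s *: w + t *: v) - h (y + t *: v).
have D1 t : 0 <= t <= s -> D (y + s *: w + t *: v).
  by move=> ts; rewrite addrAC; exact: Dab.
have D2 t : 0 <= t <= s -> D (y + t *: v).
  by move=> ts; have := Dab t 0 ts s00; rewrite scale0r addr0.
have dk t : 0 <= t <= s ->
    is_derive t 1 k ('d h (y + s *: w + t *: v) v - 'd h (y + t *: v) v).
  move=> ts; apply: is_deriveB; apply: is_derive_along; apply: dh.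
    exact: D1.
  exact: D2.
have [a /[!in_itv] /= /andP[a0 as_]] : exists2 a, a \in `]0, s[ & k s - k 0 =
    ('d h (y + s *: w + a *: v) v - 'd h (y + a *: v) v) * (s - 0).
  apply: MVT => // [x /[!in_itv] /= /andP[x0 xs]|].
    by apply: dk; rewrite !ltW.
  apply: continuous_in_subspaceT => x; rewrite inE /= in_itv /= => xs.
  by apply: differentiable_continuous; apply/derivable1_diffP; have [] := dk x xs.
rewrite subr0 => Ea.
have aa : 0 <= a <= s by rewrite !ltW.
pose l (t : R) := 'd h (y + a *: v + t *: w) v.
have dl t : 0 <= t <= s ->
    is_derive t 1 l ('d (fun z => 'd h z v) (y + a *: v + t *: w) w).
  move=> ts; apply: (@is_derive_along _ _ (fun z => 'd h z v)); apply: ddh.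
  exact: Dab.
have [b /[!in_itv] /= /andP[b0 bs]] : exists2 b, b \in `]0, s[ & l s - l 0 =
    ('d (fun z => 'd h z v) (y + a *: v + b *: w) w) * (s - 0).
  apply: MVT => // [x /[!in_itv] /= /andP[x0 xs]|].
    by apply: dl; rewrite !ltW.
  apply: continuous_in_subspaceT => x; rewrite inE /= in_itv /= => xs.
  by apply: differentiable_continuous; apply/derivable1_diffP; have [] := dl x xs.
rewrite subr0 => Eb.
exists a, b; split=> //; first by rewrite !ltW.
rewrite expr2 -mulrA [s * 'd _ _ _]mulrC -Eb /l scale0r addr0 mulrC.
rewrite [y + a *: v + s *: w]addrAC -Ea /k scale0r !addr0.
by rewrite [y + s *: v + s *: w]addrAC; ring.
Qed.

(** Both second differentials, taken at two possibly different points of the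
    same small parallelogram, equal the second difference divided by the square of
    its size; continuity makes each of them close to its value at [y]. *)
Lemma Schwarz_scalar (D : set 'rV[R]_2) (h : 'rV[R]_2 -> R) (y v w : 'rV[R]_2) :
  open D -> D y -> Coo_on D h ->
  'd (fun z => 'd h z v) y w = 'd (fun z => 'd h z w) y v.
Proof.
move=> oD Dy Ch.
have cont u u' : {for y, continuous (fun z => 'd (fun z => 'd h z u) z u')}.
  exact: (Coo_differential _ (Coo_differential _ Ch) 0%N).
pose Hvw z := 'd (fun z => 'd h z v) z w.
pose Hwv z := 'd (fun z => 'd h z w) z v.
change (Hvw y = Hwv y).
suff E e : 0 < e -> `|Hvw y - Hwv y| <= e.
  apply/eqP; rewrite -subr_eq0 -normr_le0.
  by apply/ler_addgt0Pl => e e0; rewrite addr0 E.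
move=> e0.
have [d d0 H] : exists2 d, 0 < d & forall z, `|y - z| < d ->
    [/\ D z, `|Hvw y - Hvw z| < e / 2 & `|Hwv y - Hwv z| < e / 2].
  have : \forall z \near y, 
    [/\ D z, `|Hvw y - Hvw z| < e / 2 & `|Hwv y - Hwv z| < e / 2].
    near=> z; split; first by near: z; exact: open_nbhs_nbhs.
      near: z; have /cvgrPdist_lt := cont v w; apply; exact: divr_gt0.
    near: z; have /cvgrPdist_lt := cont w v; apply; exact: divr_gt0.
  by move=> /nbhs_ballP[d /= d0 dH]; exists d => // z yz; apply: dH; rewrite -ball_normE.
(* Small enough for the parallelogram spanned at y by s v and s w to stay
   within distance d of y; the 1 makes the denominator positive. *)
pose s := d / (2 * (1 + `|v| + `|w|)).
have N0 : 0 < 1 + `|v| + `|w| by rewrite -addrA ltr_pwDl // addr_ge0.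
have s0 : 0 < s by rewrite divr_gt0 // mulr_gt0.
have near a b : 0 <= a <= s -> 0 <= b <= s -> forall z,
    z = y + a *: v + b *: w -> `|y - z| < d.
  move=> /andP[a0 as_] /andP[b0 bs] z ->.
  rewrite -!addrA opprD addrA subrr add0r normrN.
  apply: (le_lt_trans (ler_normD _ _)); rewrite !normrZ (ger0_norm a0) (ger0_norm b0).
  apply: (@le_lt_trans _ _ (s * (1 + `|v| + `|w|))).
    rewrite -addrA mulrDr mulr1 mulrDr.
    have := ler_wpM2r (normr_ge0 v) as_; have := ler_wpM2r (normr_ge0 w) bs; lra.
  rewrite /s invfM mulrA -mulrA mulVf ?gt_eqF // mulr1; lra.
have dh z : D z -> differentiable h z by exact: Coo_differentiable.
have dd u z : D z -> differentiable (fun z => 'd h z u) z.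
  by move=> Dz; apply: Coo_differentiable (Coo_differential _ Ch) Dz.
have [a1 [b1 [A1 B1 E1]]] := @second_difference D h y v w s s0 dh (dd v)
  (fun a b A B => let: And3 X _ _ := H _ (near a b A B _ erefl) in X).
have [a2 [b2 [A2 B2 E2]]] := @second_difference D h y w v s s0 dh (dd w)
  (fun a b A B => let: And3 X _ _ := H _ (near b a B A _ (addrAC _ _ _)) in X).
have [_ H1 _] := H _ (near a1 b1 A1 B1 _ erefl).
have [_ _ H2] := H _ (near b2 a2 B2 A2 _ (addrAC _ _ _)).
have E12 : Hvw (y + a1 *: v + b1 *: w) = Hwv (y + a2 *: w + b2 *: v).
  have s20 : s ^+ 2 != 0 by rewrite expf_neq0 // gt_eqF.
  apply: (mulfI s20); rewrite -[LHS]E1 -[RHS]E2 [y + s *: w + s *: v]addrAC; ring.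
apply: (le_trans (ler_distD (Hvw (y + a1 *: v + b1 *: w)) _ _)).
rewrite [leRHS]splitr; apply: lerD; first exact: ltW.
by rewrite E12 distrC; exact: ltW.
Unshelve. all: by end_near. Qed.

End Schwarz.

(** * The inner product, wedges and null rotations *)

(** The inner product, the wedge and the scaling of vectors are declared bilinear so
    that a single Leibniz rule serves all three. *)
Lemma ip_bilinear (R : realType) (n : nat) (G : 'M[R]_n.+2) :
  bilinear_for (GRing.Scale.Law.clone _ _ *:%R _)
    (GRing.Scale.Law.clone _ _ *:%R _) (@ip R n G).
Proof.
split=> [w|u] a x y; rewrite /ip /=.
  by rewrite linearP /= !mulmxDl -!scalemxAl !mxE.
by rewrite mulmxDr -scalemxAr !mxE.
Qed.

HB.instance Definition _ (R : realType) (n : nat) (G : 'M[R]_n.+2) :=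
  bilinear_isBilinear.Build R 'cV[R]_n.+2 'cV[R]_n.+2 R _ _ (@ip R n G)
    (ip_bilinear G).

Lemma wedge_bilinear (R : realType) (n : nat) (G : 'M[R]_n.+2) :
  bilinear_for (GRing.Scale.Law.clone _ _ *:%R _)
    (GRing.Scale.Law.clone _ _ *:%R _) (@wedge R n G).
Proof.
split=> [w|u] a x y; rewrite /wedge /= !linearP /= mulmxDl mulmxDl mulmxDr.
  by rewrite -!scalemxAl -!scalemxAr opprD addrACA scalerBr.
by rewrite -!scalemxAl -!scalemxAr opprD addrACA scalerBr.
Qed.

HB.instance Definition _ (R : realType) (n : nat) (G : 'M[R]_n.+2) :=
  bilinear_isBilinear.Build R 'cV[R]_n.+2 'cV[R]_n.+2 'M[R]_n.+2 _ _
    (@wedge R n G) (wedge_bilinear G).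

Lemma scale_bilinear (R : realType) (V : normedModType R) :
  bilinear_for (GRing.Scale.Law.clone _ _ *:%R _)
    (GRing.Scale.Law.clone _ _ *:%R _) (@GRing.scale R V).
Proof.
split=> [w|u] a x y /=; first by rewrite scalerDl scalerA.
by rewrite scalerDr !scalerA mulrC.
Qed.

HB.instance Definition _ (R : realType) (V : normedModType R) :=
  bilinear_isBilinear.Build R R V V _ _ (@GRing.scale R V) (scale_bilinear V).

(** In coordinates a bilinear map is a finite sum of products of coordinates with
    fixed vectors. *)
Lemma bilinear_cV_continuous (R : realType) (m n : nat) (W : normedModType R)
    (B : {bilinear 'cV[R]_m.+1 -> 'cV[R]_n.+1 -> W}) :
  continuous (fun p => B p.1 p.2).
Proof.
have delta k (u : 'cV[R]_k.+1) : u = \sum_i u i 0 *: delta_mx i 0.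
  rewrite {1}[u]matrix_sum_delta; apply: eq_bigr => i _.
  by rewrite big_ord1.
have E p : B p.1 p.2 =
    \sum_i \sum_j p.1 i 0 *: (p.2 j 0 *: B (delta_mx i 0) (delta_mx j 0)).
  rewrite {1}[p.1]delta linear_sumlz; apply: eq_bigr => i _.
  rewrite linearZl_LR /= {1}[p.2]delta linear_sumr /= scaler_sumr.
  by apply: eq_bigr => j _; rewrite linearZr_LR.
move=> p; rewrite /continuous_at E.
under eq_cvg do rewrite E.
apply: cvg_big => [|i _]; first exact: add_continuous.
apply: cvg_big => [|j _]; first exact: add_continuous.
have c1 : (fun q : 'cV[R]_m.+1 * 'cV[R]_n.+1 => q.1 i 0) q @[q --> p] --> p.1 i 0.
  apply: (@continuous_comp _ _ _ fst (fun M : 'cV[R]_m.+1 => M i 0)).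
    exact: cvg_fst.
  exact: matrix_normedtype.coord_continuous.
have c2 : (fun q : 'cV[R]_m.+1 * 'cV[R]_n.+1 => q.2 j 0) q @[q --> p] --> p.2 j 0.
  apply: (@continuous_comp _ _ _ snd (fun M : 'cV[R]_n.+1 => M j 0)).
    exact: cvg_snd.
  exact: matrix_normedtype.coord_continuous.
by apply: cvgZ => //; apply: cvgZ => //; exact: cvg_cst.
Qed.

Section Inner_product.
Context {R : realType} {n : nat} (G : 'M[R]_n.+2).
Implicit Types u v w : 'cV[R]_n.+2.

Lemma ip_continuous : continuous (fun p => ip G p.1 p.2).
Proof. exact: bilinear_cV_continuous. Qed.

Lemma wedge_continuous : continuous (fun p => wedge G p.1 p.2).
Proof. exact: bilinear_cV_continuous. Qed.

Lemma ipDl u v w : ip G (u + v) w = ip G u w + ip G v w.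
Proof. exact: linearDl. Qed.
Lemma ipDr u v w : ip G w (u + v) = ip G w u + ip G w v.
Proof. exact: linearDr. Qed.
Lemma ipZl a u w : ip G (a *: u) w = a * ip G u w.
Proof. exact: linearZl_LR. Qed.
Lemma ipZr a u w : ip G w (a *: u) = a * ip G w u.
Proof. exact: linearZr_LR. Qed.
Lemma ipNl u w : ip G (- u) w = - ip G u w.
Proof. exact: linearNl. Qed.
Lemma ipNr u w : ip G w (- u) = - ip G w u.
Proof. exact: linearNr. Qed.
Lemma ip0l w : ip G 0 w = 0.
Proof. exact: linear0l. Qed.
Lemma ip0r w : ip G w 0 = 0.
Proof. exact: linear0r. Qed.

Definition ipE := (ipDl, ipDr, ipZl, ipZr, ipNl, ipNr, ip0l, ip0r).

Lemma wedge_mul u v w : wedge G u v *m w = ip G u w *: v - ip G v w *: u.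
Proof.
rewrite /wedge mulmxBl /ip -!mulmxA.
by rewrite [X in v *m X]mx11_scalar [X in u *m X]mx11_scalar !mul_mx_scalar.
Qed.

Lemma mulmx_ext (A B : 'M[R]_n.+2) : (forall w, A *m w = B *m w) -> A = B.
Proof.
move=> AB; apply/matrixP => i j; have := AB (delta_mx j 0).
by rewrite -!colE => /matrixP/(_ i 0); rewrite !mxE.
Qed.

Hypothesis G_sym : G^T = G.

Lemma ipC u v : ip G u v = ip G v u.
Proof.
have T : (v^T *m G *m u)^T = u^T *m G *m v.
  by rewrite !trmx_mul trmxK G_sym mulmxA.
by rewrite /ip -T mxE.
Qed.

Lemma wedge_skew u v a b :
  ip G (wedge G u v *m a) b + ip G a (wedge G u v *m b) = 0.
Proof. by rewrite !wedge_mul !ipE ![ip G a _]ipC; ring. Qed.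

End Inner_product.

Lemma lorentzian_sym (R : realType) n (G : 'M[R]_n.+2) :
  lorentzian G -> G^T = G /\ G \in unitmx.
Proof.
case=> P Pu ->; split.
  by rewrite !trmx_mul trmxK tr_diag_mx mulmxA.
rewrite !unitmx_mul unitmx_tr Pu andbT /=.
rewrite unitmxE det_diag unitrE; apply/eqP; rewrite divff //.
by apply/prodf_neq0 => i _; rewrite mxE; case: ifP; rewrite ?oppr_eq0 oner_eq0.
Qed.

Section Null_rotation.
Context {R : realType} {n : nat} (G : 'M[R]_n.+2).
Hypothesis (G_sym : G^T = G).
Variables (e : 'cV[R]_n.+2) (e_null : ip G e e = 0).
Implicit Types f u v w : 'cV[R]_n.+2.

(** The partial sums of the exponential series are constant from the third on. *)
Lemma mexp_nilpotent (A : 'M[R]_n.+2) :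
  A ^+ 3 = 0 -> mexp A = 1 + A + 2^-1 *: A ^+ 2.
Proof.
move=> A3; rewrite /mexp; apply: norm_lim_near_cst; near=> k.
have k3 : (3 <= k)%N by near: k; exact: nbhs_infty_ge.
rewrite -(subnK k3) !addnS addn0 /series /=.
rewrite !big_nat_recl // big1 => [|i _].
  by rewrite addr0 expr0 expr1 !fact0 invr1 !scale1r addrA.
by rewrite [A ^+ _](exprD A 3 i) A3 mul0r scaler0.
Unshelve. all: by end_near. Qed.

(** For [e] null and [f] orthogonal to [e], the endomorphism [wedge G f e] has
    cube zero, so its exponential is a quadratic polynomial in it: the null
    rotation (parabolic isometry) that fixes [e] and translates by [f]. *)
Lemma mexp_wedge_mul f w : ip G f e = 0 ->
  mexp (wedge G f e) *m w =
  w + ip G f w *: e - ip G e w *: (f + (ip G f f / 2) *: e).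
Proof.
move=> fe; have ef : ip G e f = 0 by rewrite ipC.
have A2 u : wedge G f e *m (wedge G f e *m u) = - (ip G e u * ip G f f) *: e.
  rewrite !wedge_mul !ipE e_null fe ef.
  by apply/matrixP => i j; rewrite !mxE; ring.
rewrite mexp_nilpotent.
  have -> : wedge G f e ^+ 2 = wedge G f e *m wedge G f e by rewrite expr2.
  rewrite mulmxDl (mulmxDl 1) mul1mx -scalemxAl -mulmxA A2 wedge_mul.
  by apply/matrixP => i j; rewrite !mxE; field.
have -> : wedge G f e ^+ 3 = wedge G f e *m (wedge G f e *m wedge G f e).
  by rewrite exprS expr2.
apply: mulmx_ext => u; rewrite -!mulmxA A2.
rewrite wedge_mul !ipE e_null ef mul0mx.
by rewrite !mulr0 subr0 mul0r oppr0 scale0r.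
Qed.

Lemma mexp_wedge_isometry f u w : ip G f e = 0 ->
  ip G (mexp (wedge G f e) *m u) (mexp (wedge G f e) *m w) = ip G u w.
Proof.
move=> fe; have ef : ip G e f = 0 by rewrite ipC.
rewrite !mexp_wedge_mul // !ipE e_null fe ef (ipC G_sym u e) (ipC G_sym u f).
by field.
Qed.

End Null_rotation.

Section Isometry.
Context {R : realType} {n : nat} (G g : 'M[R]_n.+2).
Hypothesis g_isometry : forall a b, ip G (g *m a) (g *m b) = ip G a b.

(** Preserving the inner product is read off the entries of the Gram matrix; it
    is used in this matrix form to invert [g] and to conjugate wedges by it. *)
Lemma isometry_gram : g^T *m G *m g = G.
Proof.
apply/matrixP => i j.
have entry M : ((delta_mx i 0)^T *m M *m delta_mx j 0 : 'M[R]_1) 0 0 = M i j.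
  by rewrite trmx_delta -rowE -colE !mxE.
rewrite -[RHS]entry -[RHS](g_isometry (delta_mx i 0) (delta_mx j 0)) -entry.
by rewrite /ip trmx_mul !mulmxA.
Qed.

Hypothesis G_unit : G \in unitmx.

Lemma isometry_unit : g \in unitmx.
Proof. by move: G_unit; rewrite -{1}isometry_gram !unitmx_mul => /andP[]. Qed.

Lemma Ad_isometry u v : Ad g (wedge G u v) = wedge G (g *m u) (g *m v).
Proof.
rewrite /Ad; apply: (canLR (mulmxK isometry_unit)).
rewrite /wedge mulmxBr mulmxBl !trmx_mul -!mulmxA.
by rewrite (mulmxA g^T) isometry_gram.
Qed.

End Isometry.

(** * Calculus on a surface in its charts *)

Lemma diff_ipr (R : realType) (n : nat) (G : 'M[R]_n.+2) (u : 'cV[R]_n.+2)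
   (U : normedModType R) (g : U -> 'cV[R]_n.+2) (y v : U) :
  differentiable g y -> differentiable (fun z => ip G u (g z)) y /\
  'd (fun z => ip G u (g z)) y v = ip G u ('d g y v).
Proof.
move=> dg.
have dc : differentiable (fun _ : U => u) y by exact: differentiable_cst.
have d0 : 'd (fun _ : U => u) y v = 0.
  exact: (congr1 (fun F : _ -> _ => F v) (diff_cst _ y)).
have [D E] := diff_bilinear v (@ip_continuous R n G) dc dg.
split; first exact: D.
apply: (etrans E); apply: (etrans (congr1 (fun a => ip G a (g y) + _) d0)).
by rewrite ip0l add0r.
Qed.

(** Reduction to scalar maps: the Euclidean inner product with a coordinate
    vector commutes with differentiation. *)
Lemma Schwarz (R : realType) (n : nat) (D : set 'rV[R]_2)
    (g : 'rV[R]_2 -> 'cV[R]_n.+2) (y v w : 'rV[R]_2) :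
  open D -> D y -> Coo_on D g ->
  'd (fun z => 'd g z v) y w = 'd (fun z => 'd g z w) y v.
Proof.
move=> oD Dy Cg; apply/matrixP => i j; rewrite ord1 {j}.
pose c := ip (1%:M : 'M[R]_n.+2) (delta_mx i 0).
have cE u : c u = u i 0.
  by rewrite /c /ip mulmx1 trmx_delta -rowE mxE.
have dc (g' : 'rV[R]_2 -> 'cV[R]_n.+2) z u : differentiable g' z ->
    'd (c \o g') z u = c ('d g' z u).
  by move=> /(diff_ipr 1%:M (delta_mx i 0) u)[].
have Cc : Coo_on D (c \o g).
  by move=> k; apply: Ck_bilin => //; [exact: ip_continuous|exact: Ck_cst].
have dd u u' : 'd (fun z => 'd (c \o g) z u) y u' = ('d (fun z => 'd g z u) y u') i 0.
  have dgu : differentiable (fun z => 'd g z u) y.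
    exact: Coo_differentiable (Coo_differential _ Cg) Dy.
  have [D1 _] := diff_ipr 1%:M (delta_mx i 0) 0 dgu.
  have cE' : \forall z \near y, (c \o fun z => 'd g z u) z = 'd (c \o g) z u.
    apply: open_near oD Dy _ => z Dz; apply: esym; apply: dc.
    exact: Coo_differentiable Cg Dz.
  have [_ E] := near_diff cE' D1.
  by rewrite -cE; apply: (etrans (E u')); exact: dc.
exact: (etrans (esym (dd v w)) (etrans (Schwarz_scalar v w oD Dy Cc) (dd w v))).
Qed.

Section Surface_calculus.
Context {R : realType} {S : smoothSurface R}.
Implicit Types (U V W : normedModType R) (i j : chart S) (x : S).

Definition chart_image i : set 'rV[R]_2 := coords i @` dom i.

Lemma coordsP i x : dom i x -> chart_image i (coords i x).
Proof. by exists x. Qed.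

Lemma paramP i y : chart_image i y -> dom i (param i y) /\ coords i (param i y) = y.
Proof. by move=> [x dx <-]; rewrite coordK. Qed.

Lemma open_coords_image i (A : set S) : open A -> open (coords i @` (A `&` dom i)).
Proof.
move=> oA.
have -> : coords i @` (A `&` dom i) = chart_image i `&` param i @^-1` A.
  apply/seteqP; split=> [_ [x [Ax dx] <-]|y [[x dx <-]]].
    by split; [exists x|rewrite /= coordK].
  by rewrite /= coordK // => Ax; exists x.
have oD := @coord_open _ S i; have := @param_continuous _ S i.
by rewrite continuous_open_subspace // => /(continuous_inP _ oD); apply.
Qed.

Lemma near_chart V i x (g h : S -> V) (A : set S) : open A -> A x -> dom i x ->
  (forall z, A z -> g z = h z) ->
  \forall y \near coords i x, (g \o param i) y = (h \o param i) y.
Proof.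
move=> oA Ax dx gh; apply: open_near (@open_coords_image i _ oA) _ _.
  by exists x.
by move=> _ [z [Az dz] <-] /=; rewrite coordK // gh.
Qed.

(** Smoothness read in a single chart.  The values of a 1-form on a coordinate
    vector field are functions attached to one chart, so smoothness with respect
    to all charts would be unsuitable for them. *)
Definition smooth_in V i (g : S -> V) := Coo_on (chart_image i) (g \o param i).

Lemma smoothP V (g : S -> V) : smooth g <-> forall i, smooth_in i g.
Proof.
by split=> Cg i; have := Cg i; rewrite /smooth_in /chart_image setTI.
Qed.

Lemma smooth_in_congr V i (g h : S -> V) :
  (forall z, dom i z -> g z = h z) -> smooth_in i g -> smooth_in i h.
Proof.
move=> gh Cg k; apply: Ck_congr (@coord_open _ S i) _ (Cg k) => y /paramP[dy _] /=.
exact: gh.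
Qed.

Lemma smooth_in_cst V i (c : V) : smooth_in i (fun=> c).
Proof. by move=> k; exact: Ck_cst. Qed.

Lemma smooth_in_add V i (g h : S -> V) :
  smooth_in i g -> smooth_in i h -> smooth_in i (fun x => g x + h x).
Proof. by move=> Cg Ch k; exact: (Ck_add (@coord_open _ S i) (Cg k) (Ch k)). Qed.

Lemma smooth_in_bilin U V W i (B : {bilinear U -> V -> W})
    (g : S -> U) (h : S -> V) : continuous (fun p => B p.1 p.2) ->
  smooth_in i g -> smooth_in i h -> smooth_in i (fun x => B (g x) (h x)).
Proof. by move=> cB Cg Ch k; exact: (Ck_bilin cB (@coord_open _ S i) (Cg k) (Ch k)). Qed.

Lemma smooth_in_dfun V i v (g : S -> V) :
  smooth_in i g -> smooth_in i (fun z => dfun g i z v).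
Proof.
move=> Cg k; apply: Ck_congr (@coord_open _ S i) _ (Coo_differential v Cg k) => y Dy /=.
by rewrite /dfun (paramP Dy).2.
Qed.

(** Differentiability in one chart at one point: for a lift defined on an open
    subset, neither smoothness on the surface nor on a whole chart is available. *)
Definition diff_at V i x (g : S -> V) := differentiable (g \o param i) (coords i x).

Lemma smooth_on_diff V i x (A : set S) (g : S -> V) :
  A x -> dom i x -> smooth_on A g -> diff_at i x g.
Proof. by move=> Ax dx /(_ i) Cg; apply: Coo_differentiable Cg _; exists x. Qed.

Lemma smooth_in_diff V i x (g : S -> V) : dom i x -> smooth_in i g -> diff_at i x g.
Proof. by move=> dx Cg; exact: Coo_differentiable Cg (coordsP dx). Qed.

Lemma dfun_cst V i x v (c : V) : dfun (fun _ : S => c) i x v = 0.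
Proof. by rewrite /dfun (diff_cst c (coords i x)). Qed.

Lemma dfun_near V i x v (g h : S -> V) (A : set S) :
  open A -> A x -> dom i x -> (forall z, A z -> g z = h z) ->
  diff_at i x g -> dfun h i x v = dfun g i x v.
Proof.
move=> oA Ax dx gh dg.
by have [_] := near_diff (near_chart oA Ax dx gh) dg; apply.
Qed.

Lemma dfun_add V i x v (g h : S -> V) : diff_at i x g -> diff_at i x h ->
  dfun (fun x => g x + h x) i x v = dfun g i x v + dfun h i x v.
Proof. by move=> dg dh; have [] := diff_add v dg dh. Qed.

Lemma dfun_bilin U V W (B : {bilinear U -> V -> W}) (g : S -> U) (h : S -> V)
    i x v : continuous (fun p => B p.1 p.2) -> dom i x ->
  diff_at i x g -> diff_at i x h ->
  dfun (fun x => B (g x) (h x)) i x v =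
  B (dfun g i x v) (h x) + B (g x) (dfun h i x v).
Proof.
move=> cB dx dg dh; have [_] := diff_bilinear v cB dg dh.
by rewrite /dfun /= coordK.
Qed.

Lemma smooth_in_opp V i (g : S -> V) : smooth_in i g -> smooth_in i (fun x => - g x).
Proof.
move=> Cg; have C := smooth_in_bilin (@scale_continuous R V)
  (smooth_in_cst i (-1 : R)) Cg.
by apply: smooth_in_congr C => z _ /=; rewrite scaleN1r.
Qed.

Lemma dfun_opp V i x v (g : S -> V) : dom i x -> smooth_in i g ->
  dfun (fun x => - g x) i x v = - dfun g i x v.
Proof.
move=> dx Cg; apply/eqP; rewrite -addr_eq0; apply/eqP.
have D := smooth_in_diff dx.
rewrite -(dfun_add v (D _ _ (smooth_in_opp Cg)) (D _ _ Cg)).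
have -> : (fun x => - g x + g x) = fun=> 0 by apply/funext => z; rewrite addNr.
exact: dfun_cst.
Qed.

Lemma dfun_linear V i x (g : S -> V) (c : R) v w :
  dfun g i x (c *: v + w) = c *: dfun g i x v + dfun g i x w.
Proof. by rewrite /dfun linearP. Qed.

(** The chain rule for a change of charts; this is what makes the forms built from
    differentials independent of the chart. *)
Lemma dfun_transition V i j x v (g : S -> V) : smooth g -> dom i x -> dom j x ->
  dfun g i x v = dfun g j x ('d (coords j \o param i) (coords i x) v).
Proof.
move=> sg dxi dxj.
have dt : differentiable (coords j \o param i) (coords i x).
  by apply: Coo_differentiable (@transition_smooth _ S i j) _; exists x.
have xE : (coords j \o param i) (coords i x) = coords j x by rewrite /= coordK.
have dg : differentiable (g \o param j) ((coords j \o param i) (coords i x)).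
  by rewrite xE; exact: smooth_in_diff dxj ((smoothP _).1 sg j).
have dgt := differentiable_comp dt dg.
have E : \forall y \near coords i x,
    ((g \o param j) \o (coords j \o param i)) y = (g \o param i) y.
  apply: open_near (@open_coords_image i _ (@dom_open _ S j)) _ _; first by exists x.
  by move=> _ [z [dzj dzi] <-] /=; rewrite !coordK.
have [_ D] := near_diff E dgt; apply: (etrans (D v)).
apply: (etrans (congr1 (fun F : _ -> _ => F v) (diff_comp dt dg))).
exact: (congr1 (fun y => 'd (g \o param j) y _) xE).
Qed.

Lemma dform_near (V : normedModType R) (a b : vform S V) i x v w :
  dom i x -> eq_form a b -> smooth_1form b -> dform a i x v w = dform b i x v w.
Proof.
move=> dx ab [_ _ Cb].
have E u u' : 'd (fun y => a i (param i y) u) (coords i x) u' =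
    'd (fun y => b i (param i y) u) (coords i x) u'.
  have [||_ //] := @near_diff _ _ _ (fun y => b i (param i y) u)
    (fun y => a i (param i y) u) (coords i x).
    apply: open_near (@coord_open _ S i) (coordsP dx) _ => y /paramP[dy _].
    by rewrite ab.
  exact: Coo_differentiable (Cb i u) (coordsP dx).
exact: (congr2 (fun p q => p - q) (E w v) (E v w)).
Qed.

Lemma smooth_1form_eq (V : normedModType R) (a b : vform S V) :
  eq_form a b -> smooth_1form b -> smooth_1form a.
Proof.
move=> ab [b1 b2 b3]; split=> [i x dx c v w|i j x v dxi dxj|i v k].
- by rewrite !ab //; exact: b1.
- by rewrite !ab //; exact: b2.
apply: Ck_congr (@coord_open _ S i) _ (b3 i v k) => y /paramP[dy _].
by rewrite ab.
Qed.

(** Equality of mixed partial derivatives, in the form d(dg) = 0. *)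
Lemma dfun_sym n i x v w (g : S -> 'cV[R]_n.+2) : smooth_in i g -> dom i x ->
  dfun (fun z => dfun g i z w) i x v = dfun (fun z => dfun g i z v) i x w.
Proof.
move=> Cg dx.
have E u u' : dfun (fun z => dfun g i z u) i x u' =
    'd (fun y => 'd (g \o param i) y u) (coords i x) u'.
  have dg := Coo_differentiable (Coo_differential u Cg) (coordsP dx).
  have N : \forall y \near coords i x,
      'd (g \o param i) y u = ((fun z => dfun g i z u) \o param i) y.
    apply: open_near (@coord_open _ S i) (coordsP dx) _ => y /paramP[_ yE] /=.
    by rewrite /dfun yE.
  have [_ E] := near_diff N dg; exact: (E u').
have Sz := Schwarz v w (@coord_open _ S i) (coordsP dx) Cg.
exact: (etrans (E w v) (etrans (esym Sz) (esym (E v w)))).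
Qed.

End Surface_calculus.

Section Products.
Context {R : realType} {S : smoothSurface R} {n : nat} (G : 'M[R]_n.+2).
Variables (i : chart S) (x : S).
Implicit Types (g h : S -> 'cV[R]_n.+2) (a : S -> R).

Lemma smooth_in_ip g h :
  smooth_in i g -> smooth_in i h -> smooth_in i (fun z => ip G (g z) (h z)).
Proof. exact: (smooth_in_bilin (@ip_continuous R n G)). Qed.

Lemma smooth_in_wedge g h :
  smooth_in i g -> smooth_in i h -> smooth_in i (fun z => wedge G (g z) (h z)).
Proof. exact: (smooth_in_bilin (@wedge_continuous R n G)). Qed.

Lemma smooth_in_scale a g :
  smooth_in i a -> smooth_in i g -> smooth_in i (fun z => a z *: g z).
Proof. exact: (smooth_in_bilin (@scale_continuous R _)). Qed.

Lemma diff_at_ip g h :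
  diff_at i x g -> diff_at i x h -> diff_at i x (fun z => ip G (g z) (h z)).
Proof. by move=> dg dh; have [] := diff_bilinear 0 (@ip_continuous R n G) dg dh. Qed.

Lemma diff_at_scale a g :
  diff_at i x a -> diff_at i x g -> diff_at i x (fun z => a z *: g z).
Proof.
move=> dg dh.
by have [] := diff_bilinear 0 (@scale_continuous R 'cV[R]_n.+2) dg dh.
Qed.

Lemma dfun_ip g h v : dom i x -> diff_at i x g -> diff_at i x h ->
  dfun (fun z => ip G (g z) (h z)) i x v =
  ip G (dfun g i x v) (h x) + ip G (g x) (dfun h i x v).
Proof. exact: (dfun_bilin v (@ip_continuous R n G)). Qed.

Lemma dfun_wedge g h v : dom i x -> diff_at i x g -> diff_at i x h ->
  dfun (fun z => wedge G (g z) (h z)) i x v =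
  wedge G (dfun g i x v) (h x) + wedge G (g x) (dfun h i x v).
Proof. exact: (dfun_bilin v (@wedge_continuous R n G)). Qed.

Lemma dfun_scale a g v : dom i x -> diff_at i x a -> diff_at i x g ->
  dfun (fun z => a z *: g z) i x v =
  dfun a i x v *: g x + a x *: dfun g i x v.
Proof. exact: (dfun_bilin v (@scale_continuous R _)). Qed.

End Products.

(** * Null line bundles swept out by null rotations *)

(** The rank condition of an immersed line bundle, as injectivity of the map
    (c, v) |-> c a + l v on the sum of a line and the tangent plane. *)
Lemma dim_span3P (R : realType) (n : nat) (a : 'cV[R]_n.+2)
    (l : {linear 'rV[R]_2 -> 'cV[R]_n.+2}) :
  \dim <<[:: a; l (delta_mx 0 0); l (delta_mx 0 1)]>> = 3%N <->
  (forall c v, c *: a + l v = 0 -> c = 0 /\ v = 0).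
Proof.
have vE (v : 'rV[R]_2) : v = v 0 0 *: delta_mx 0 0 + v 0 1 *: delta_mx 0 1.
  apply/rowP => j; rewrite !mxE /=; case: j => [[|[|//]]] jlt /=;
    rewrite ?mulr1 ?mulr0 ?addr0 ?add0r; congr (v 0 _); exact/val_inj.
have freeE : (\dim <<[:: a; l (delta_mx 0 0); l (delta_mx 0 1)]>> = 3%N) <->
    free [tuple a; l (delta_mx 0 0); l (delta_mx 0 1)].
  by rewrite /free /=; split => [->|/eqP].
rewrite freeE; split=> [/freeP F c v cv|F].
  have /F k0 : \sum_(i < 3) [tuple c; v 0 0; v 0 1]`_i *:
      [tuple a; l (delta_mx 0 0); l (delta_mx 0 1)]`_i = 0.
    by rewrite !big_ord_recl big_ord0 /= addr0 -cv [in RHS](vE v) linearP linearZ.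
  have := (k0 0, k0 1, k0 2%:R) => /= -[[-> v0] v1]; split=> //.
  by rewrite [v]vE v0 v1 !scale0r addr0.
apply/freeP => k; rewrite !big_ord_recl big_ord0 /= addr0 => k0.
pose v := k (lift ord0 ord0) *: delta_mx 0 0 +
          k (lift ord0 (lift ord0 ord0)) *: delta_mx 0 1 : 'rV[R]_2.
have [|c0 v0] := F (k ord0) v; first by rewrite /v linearP linearZ.
have v00 := congr1 (fun u : 'rV_2 => u 0 0) v0.
have v01 := congr1 (fun u : 'rV_2 => u 0 1) v0.
rewrite /v !mxE /= ?mulr1 ?mulr0 ?addr0 ?add0r in v00 v01.
move=> [[|[|[|//]]] ilt].
- by rewrite -c0; congr (k _); exact/val_inj.
- by rewrite -v00; congr (k _); exact/val_inj.
- by rewrite -v01; congr (k _); exact/val_inj.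
Qed.

Section Light_cone_chart.
Context {R : realType} {S : smoothSurface R} {n : nat} (G : 'M[R]_n.+2).
Hypotheses (G_sym : G^T = G) (G_unit : G \in unitmx).
Variables (e o : 'cV[R]_n.+2).
Hypotheses (e_null : ip G e e = 0) (o_null : ip G o o = 0) (oe : ip G o e = -1).
Variable f : S -> 'cV[R]_n.+2.
Hypotheses (f_smooth : smooth f).
Hypotheses (ef : forall x, ip G e (f x) = 0) (of_ : forall x, ip G o (f x) = 0).
Implicit Types (i : chart S) (x : S) (v w : 'rV[R]_2) (u : 'cV[R]_n.+2).

Let eo : ip G e o = -1. Proof. by rewrite ipC. Qed.
Let fe x : ip G (f x) e = 0. Proof. by rewrite ipC. Qed.
Let fo x : ip G (f x) o = 0. Proof. by rewrite ipC. Qed.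

Definition null_rotation x := mexp (wedge G (f x) e).
Local Notation rot := null_rotation.
(** The lift o + f + (f, f)/2 e of the map [f] into the light cone, normalised by
    having inner product -1 with [e]. *)
Definition cone_lift x := rot x *m o.
Local Notation point := cone_lift.

Lemma null_rotation_isometry x u u' : ip G (rot x *m u) (rot x *m u') = ip G u u'.
Proof. exact: mexp_wedge_isometry. Qed.

Lemma null_rotation_unit x : rot x \in unitmx.
Proof. exact: isometry_unit (null_rotation_isometry x) G_unit. Qed.

Lemma null_rotation_perp x u : ip G e u = 0 -> rot x *m u = u + ip G (f x) u *: e.
Proof. by move=> eu; rewrite /null_rotation mexp_wedge_mul // eu scale0r subr0. Qed.

Lemma null_rotation_e x : rot x *m e = e.
Proof. by rewrite null_rotation_perp // fe scale0r addr0. Qed.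

Lemma cone_liftE x : point x = o + f x + (ip G (f x) (f x) / 2) *: e.
Proof.
rewrite /cone_lift /null_rotation mexp_wedge_mul // fo eo scale0r addr0 scaleN1r opprK.
by rewrite addrA.
Qed.

Lemma cone_lift_null x : ip G (point x) (point x) = 0.
Proof. by rewrite null_rotation_isometry. Qed.

Lemma cone_lift_e x : ip G (point x) e = -1.
Proof. by rewrite -[X in ip G _ X](null_rotation_e x) null_rotation_isometry. Qed.

Lemma cone_lift_neq0 x : point x != 0.
Proof.
apply/eqP => p0; have := cone_lift_e x; rewrite p0 ip0l => /eqP.
by rewrite eq_sym oppr_eq0 oner_eq0.
Qed.

Let f_in i : smooth_in i f := (smoothP f).1 f_smooth i.

Lemma smooth_in_cone_lift i : smooth_in i point.
Proof.
apply: (@smooth_in_congr _ _ _ _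
  (fun x => o + f x + ip G (f x) (f x) *: (2^-1 *: e))) => [x _|].
  by rewrite cone_liftE scalerA.
apply: smooth_in_add.
  by apply: smooth_in_add; [exact: smooth_in_cst|exact: f_in].
by apply: smooth_in_scale; [exact: smooth_in_ip|exact: smooth_in_cst].
Qed.

Lemma dfun_orth i x v u : dom i x -> (forall z, ip G u (f z) = 0) ->
  ip G u (dfun f i x v) = 0.
Proof.
move=> dx uf; have dfx := smooth_in_diff dx (f_in i).
have E := dfun_ip G v dx (smooth_in_diff dx (smooth_in_cst i u)) dfx.
rewrite dfun_cst ip0l add0r in E; rewrite -E.
have -> : (fun z => ip G u (f z)) = fun=> 0 by apply/funext.
exact: dfun_cst.
Qed.

(** The null rotation moving [o] to the lift also moves df to the differential of
    the lift: the term (f, df) e is the derivative of (f, f)/2 e. *)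
Lemma dfun_cone_lift i x v : dom i x -> dfun point i x v = rot x *m dfun f i x v.
Proof.
move=> dx; have dfx := smooth_in_diff dx (f_in i).
have dc u := smooth_in_diff dx (smooth_in_cst i u).
rewrite null_rotation_perp; last exact: dfun_orth.
have -> : point = fun x => o + f x + ip G (f x) (f x) *: (2^-1 *: e).
  by apply/funext => z; rewrite cone_liftE scalerA.
have sff := smooth_in_ip G (f_in i) (f_in i).
have so := smooth_in_add (smooth_in_cst i o) (f_in i).
have se := smooth_in_cst i (2^-1 *: e).
have sc := smooth_in_scale sff se.
rewrite (dfun_add v (smooth_in_diff dx so) (smooth_in_diff dx sc)).
rewrite (dfun_add v (dc o) dfx) dfun_cst add0r.
rewrite (dfun_scale v dx (smooth_in_diff dx sff) (dc _)) dfun_cst scaler0 addr0.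
rewrite (dfun_ip G v dx dfx dfx) (ipC G_sym (dfun _ _ _ _)) scalerA.
by congr (_ + _ *: _); field.
Qed.

Lemma cone_lift_bundle (L : S -> {vspace 'cV[R]_n.+2}) :
  (forall x, L x = <[point x]>%VS) -> null_line_bundle G L.
Proof.
move=> LE; split=> [x|x u|x].
- by rewrite LE dim_vline cone_lift_neq0.
- by rewrite LE => /vlineP[c ->]; rewrite !ipE cone_lift_null !mulr0.
exists setT, point; split=> //; first exact: openT.
split=> [|z _]; last by rewrite LE memv_line cone_lift_neq0.
by apply/smoothP => i; exact: smooth_in_cone_lift.
Qed.

(** A lift F equals lam times the normalised lift, with lam = - (F, e) as smooth
    as F.  Rotating a relation c F + dF(v) = 0 back to [o] gives
    (c lam + dlam(v)) o + lam df(v) = 0, whose two terms are independent: the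
    first has a component along [o] and the second is orthogonal to [e]. *)
Lemma cone_lift_immersion (L : S -> {vspace 'cV[R]_n.+2}) :
  (forall x, L x = <[point x]>%VS) ->
  (forall i x, dom i x -> injective (dfun f i x)) -> line_immersion L.
Proof.
move=> LE inj U F oU [sF LF] i x Ux dx.
apply/(dim_span3P (F x) ('d (F \o param i) (coords i x))) => c v cv.
have dF := smooth_on_diff Ux dx sF.
pose lam z := ip G (F z) (- e).
have FE z : U z -> lam z *: point z = F z.
  move=> /LF [+ _]; rewrite LE /lam => /vlineP[k ->].
  by rewrite !ipE cone_lift_e mulrN1 opprK.
have lam0 : lam x != 0.
  have [_] := LF x Ux; apply: contra => /eqP l0.
  by rewrite -(FE x Ux) l0 scale0r.
have dlam : diff_at i x lam.
  exact: diff_at_ip dF (smooth_in_diff dx (smooth_in_cst i _)).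
have dpt := smooth_in_diff dx (smooth_in_cone_lift i).
have E : dfun F i x v = dfun lam i x v *: point x + lam x *: dfun point i x v.
  rewrite (dfun_near v oU Ux dx FE (diff_at_scale dlam dpt)).
  exact: dfun_scale.
have {}cv : (c * lam x + dfun lam i x v) *: o + lam x *: dfun f i x v = 0.
  apply: (can_inj (mulKmx (null_rotation_unit x))); rewrite mulmx0 -cv.
  have -> : 'd (F \o param i) (coords i x) v = dfun F i x v by [].
  by rewrite E dfun_cone_lift // -(FE x Ux) mulmxDr -!scalemxAr scalerDl scalerA addrA.
have k0 : c * lam x + dfun lam i x v = 0.
  have := congr1 (ip G e) cv; rewrite !ipE eo dfun_orth // mulr0 addr0 mulrN1.
  by move/eqP; rewrite oppr_eq0 => /eqP.
have dl0 : dfun lam i x (0 : 'rV[R]_2) = 0 by rewrite /dfun linear0.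
have df0 : dfun f i x (0 : 'rV[R]_2) = 0 by rewrite /dfun linear0.
have v0 : v = 0.
  apply: (inj i x dx); rewrite df0; apply/eqP.
  move: cv; rewrite k0 scale0r add0r => /eqP.
  by rewrite scaler_eq0 (negbTE lam0).
split=> //; apply/eqP; move: k0; rewrite v0 dl0 addr0 => /eqP.
by rewrite mulf_eq0 (negbTE lam0) orbF.
Qed.

Lemma immersion_of_cone_lift (L : S -> {vspace 'cV[R]_n.+2}) i x v :
  (forall x, L x = <[point x]>%VS) -> line_immersion L -> dom i x ->
  dfun f i x v = 0 -> v = 0.
Proof.
move=> LE imm dx dfv.
have lift : lift_on L setT point.
  split=> [|z _]; last by rewrite LE memv_line cone_lift_neq0.
  by apply/smoothP => j; exact: smooth_in_cone_lift.
have /(dim_span3P (point x) ('d (point \o param i) (coords i x))) I :=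
  imm _ _ openT lift i x Logic.I dx.
have [|//] := I 0 v.
have -> : 'd (point \o param i) (coords i x) v = dfun point i x v by [].
by rewrite scale0r add0r dfun_cone_lift // dfv mulmx0.
Qed.

End Light_cone_chart.

(** * The isothermic form and its closedness *)

Lemma Ad_linear (R : realType) (n : nat) (g : 'M[R]_n.+2) (c : R) (A B : 'M[R]_n.+2) :
  Ad g (c *: A + B) = c *: Ad g A + Ad g B.
Proof. by rewrite /Ad mulmxDr mulmxDl -scalemxAr -scalemxAl. Qed.

Lemma AdB (R : realType) (n : nat) (g A B : 'M[R]_n.+2) :
  Ad g (A - B) = Ad g A - Ad g B.
Proof. by rewrite /Ad mulmxBr mulmxBl. Qed.

Lemma Ad_eq0 (R : realType) (n : nat) (g A : 'M[R]_n.+2) :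
  g \in unitmx -> Ad g A = 0 -> A = 0.
Proof.
move=> gu A0; have : invmx g *m Ad g A *m g = A.
  by rewrite /Ad -!mulmxA mulKmx // mulVmx // mulmx1.
by rewrite A0 mulmx0 mul0mx.
Qed.

Lemma wedgeDl (R : realType) (n : nat) (G : 'M[R]_n.+2) u v w :
  wedge G (u + v) w = wedge G u w + wedge G v w.
Proof. exact: linearDl. Qed.

Lemma wedgeZl (R : realType) (n : nat) (G : 'M[R]_n.+2) a u w :
  wedge G (a *: u) w = a *: wedge G u w.
Proof. exact: linearZl_LR. Qed.

Lemma wedgeNr (R : realType) (n : nat) (G : 'M[R]_n.+2) u w :
  wedge G w (- u) = - wedge G w u.
Proof. exact: linearNr. Qed.

Lemma wedgeC (R : realType) (n : nat) (G : 'M[R]_n.+2) u v :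
  wedge G u v = - wedge G v u.
Proof. by rewrite /wedge opprB. Qed.

Section Christoffel_form.
Context {R : realType} {S : smoothSurface R} {n : nat} (G : 'M[R]_n.+2).
Hypotheses (G_sym : G^T = G) (G_unit : G \in unitmx).
Variables (e o : 'cV[R]_n.+2).
Hypotheses (e_null : ip G e e = 0) (o_null : ip G o o = 0) (oe : ip G o e = -1).
Variables f h : S -> 'cV[R]_n.+2.
Hypotheses (f_smooth : smooth f) (h_smooth : smooth h).
Hypotheses (ef : forall x, ip G e (f x) = 0) (of_ : forall x, ip G o (f x) = 0).
Hypotheses (eh : forall x, ip G e (h x) = 0) (oh : forall x, ip G o (h x) = 0).
Implicit Types (i : chart S) (x : S) (v w : 'rV[R]_2) (u : 'cV[R]_n.+2).
Local Notation rot := (null_rotation G e f).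
Local Notation point := (cone_lift G e o f).

(** Evaluated on [e], the wedges of vectors orthogonal to [e] disappear and
    [wedge G e o] gives back [e]. *)
Lemma boost_coef s a b A B : s *: wedge G e o + (wedge G b A - wedge G a B) = 0 ->
  ip G e A = 0 -> ip G e B = 0 -> ip G e a = 0 -> ip G e b = 0 -> s = 0.
Proof.
move=> K0 eA eB ea eb; have := congr1 (fun M => ip G o (M *m e)) K0.
rewrite mul0mx mulmxDl mulmxBl -scalemxAl !wedge_mul !ipE e_null oe.
by rewrite ![ip G _ e](ipC G_sym) eA eB ea eb; lra.
Qed.

(** With [e], [o] = [vinf], [v0] and [f], [h] the surface and its Christoffel
    transform, this is the form of the surface; exchanging both pairs gives the
    form of the transform.  Every result about it is therefore available on both
    sides. *)
Definition chr_form : vform S 'M[R]_n.+2 :=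
  fun i x v => Ad (rot x) (wedge G (dfun h i x v) o).

Let iso x : forall a b, ip G (rot x *m a) (rot x *m b) = ip G a b.
Proof. by move=> a b; exact: null_rotation_isometry. Qed.

Let dhe i x v : dom i x -> ip G e (dfun h i x v) = 0.
Proof. by move=> dx; exact: dfun_orth. Qed.

Let dho i x v : dom i x -> ip G o (dfun h i x v) = 0.
Proof. by move=> dx; exact: dfun_orth. Qed.

Let dfe i x v : dom i x -> ip G e (dfun f i x v) = 0.
Proof. by move=> dx; exact: dfun_orth. Qed.

Lemma chr_form_rot i x v :
  chr_form i x v = wedge G (rot x *m dfun h i x v) (point x).
Proof. exact: (Ad_isometry (iso x) G_unit). Qed.

Lemma chr_formE i x v : dom i x ->
  chr_form i x v =
  wedge G (dfun h i x v + ip G (f x) (dfun h i x v) *: e) (point x).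
Proof.
by move=> dx; rewrite chr_form_rot (null_rotation_perp G_sym e_null ef) // dhe.
Qed.

Let f_in i : smooth_in i f := (smoothP f).1 f_smooth i.
Let h_in i : smooth_in i h := (smoothP h).1 h_smooth i.
Let pt_in i : smooth_in i point.
Proof. exact: smooth_in_cone_lift. Qed.

Let smooth_factor i v :
  smooth_in i (fun x => dfun h i x v + ip G (f x) (dfun h i x v) *: e).
Proof.
have dh := smooth_in_dfun v (h_in i).
apply: (smooth_in_add dh); apply: smooth_in_scale; last exact: smooth_in_cst.
exact: (smooth_in_ip G (f_in i) dh).
Qed.

Lemma chr_form_smooth : smooth_1form chr_form.
Proof.
split=> [i x dx c v w|i j x v dxi dxj|i v].
- rewrite !chr_form_rot (dfun_linear i x h c v w) mulmxDr -scalemxAr.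
  by rewrite wedgeDl wedgeZl.
- exact: (congr1 (fun a => Ad (rot x) (wedge G a o)) (dfun_transition v h_smooth dxi dxj)).
suff C : smooth_in i (fun x => chr_form i x v) by exact: C.
have C := smooth_in_wedge G (smooth_factor i v) (pt_in i).
by apply: smooth_in_congr C => z dz; rewrite chr_formE.
Qed.

(** In the rotating frame the second differentials of [h] occur symmetrically and
    cancel.  What remains has a scalar part, along e ^ o, and a part in the second
    exterior power of the orthogonal complement of [e] and [o]. *)
Lemma dform_chr_form i x v w : dom i x ->
  dform chr_form i x v w = Ad (rot x)
    ((ip G (dfun f i x v) (dfun h i x w) - ip G (dfun f i x w) (dfun h i x v))
       *: wedge G e o
     + (wedge G (dfun h i x w) (dfun f i x v)
        - wedge G (dfun h i x v) (dfun f i x w))).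
Proof.
move=> dx.
have dd (u u' : 'rV[R]_2) : dfun (fun z => chr_form i z u') i x u =
    wedge G (dfun (fun z => dfun h i z u') i x u
       + ip G (f x) (dfun (fun z => dfun h i z u') i x u) *: e) (point x)
    + ip G (dfun f i x u) (dfun h i x u') *: wedge G e (point x)
    + wedge G (rot x *m dfun h i x u') (rot x *m dfun f i x u).
  have Cdh := smooth_in_dfun u' (h_in i).
  have Cip := smooth_in_ip G (f_in i) Cdh.
  have Csc := smooth_in_scale Cip (smooth_in_cst i e).
  have D := smooth_in_diff dx.
  rewrite (dfun_near u (@dom_open _ S i) dx dx
    (fun z dz => esym (chr_formE u' dz))
    (D _ _ (smooth_in_wedge G (smooth_factor i u') (pt_in i)))).
  rewrite (dfun_wedge G u dx (D _ _ (smooth_factor i u')) (D _ _ (pt_in i))).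
  rewrite (dfun_add u (D _ _ Cdh) (D _ _ Csc)).
  rewrite (dfun_scale u dx (D _ _ Cip) (D _ _ (smooth_in_cst i e))).
  rewrite (dfun_ip G u dx (D _ _ (f_in i)) (D _ _ Cdh)).
  rewrite dfun_cst scaler0 addr0 (dfun_cone_lift G_sym e_null oe) //.
  rewrite -(null_rotation_perp G_sym e_null ef x (dhe u' dx)); congr (_ + _).
  rewrite scalerDl addrCA wedgeDl wedgeZl; exact: addrC.
have -> : dform chr_form i x v w = dfun (fun z => chr_form i z w) i x v -
  dfun (fun z => chr_form i z v) i x w by [].
have alg (V : zmodType) (a b c b' c' : V) :
    a + b + c - (a + b' + c') = (b - b') + (c - c').
  by rewrite -(addrA a b) -(addrA a b') opprD addrACA subrr add0r opprD addrACA.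
rewrite !dd (dfun_sym v w (h_in i) dx) alg -scalerBl Ad_linear AdB.
by rewrite !(Ad_isometry (iso x) G_unit) (null_rotation_e G_sym e_null ef).
Qed.

(** The two parts of the exterior derivative vanish separately, and the
    resulting conditions are symmetric under exchange of [f] and [h].  This is why
    the form of the Christoffel transform is closed as soon as the original one
    is. *)
Lemma closed_chr_formP : closed_1form chr_form <->
  forall i x v w, dom i x ->
    ip G (dfun f i x v) (dfun h i x w) = ip G (dfun f i x w) (dfun h i x v) /\
    wedge G (dfun h i x w) (dfun f i x v) = wedge G (dfun h i x v) (dfun f i x w).
Proof.
split=> [closed i x v w dx|sym i x v w dx]; last first.
  have [s1 s2] := sym i x v w dx.
  by rewrite dform_chr_form // s1 s2 !subrr scale0r addr0 /Ad mulmx0 mul0mx.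
have := closed i x v w dx; rewrite dform_chr_form //.
move=> /(Ad_eq0 (null_rotation_unit G_sym G_unit e_null ef x)) K0.
have s0 := boost_coef K0 (dfe v dx) (dfe w dx) (dhe v dx) (dhe w dx).
split; first by apply/eqP; rewrite -subr_eq0 s0.
by apply/eqP; rewrite -subr_eq0; move: K0; rewrite s0 scale0r add0r => ->.
Qed.

Lemma chr_form_values (L : S -> {vspace 'cV[R]_n.+2}) i x v :
  (forall x, L x = <[point x]>%VS) -> dom i x ->
  o_alg G (chr_form i x v) /\
  wedge_span G [set` L x] (orth G [set` L x]) (chr_form i x v).
Proof.
move=> LE dx; rewrite chr_form_rot; split=> [a b|]; first exact: wedge_skew.
exists 1%N, (fun=> point x), (fun=> - (rot x *m dfun h i x v)); split.
- by move=> _ /=; rewrite LE memv_line.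
- move=> _ u /=; rewrite LE => /vlineP[c ->].
  by rewrite !ipE iso dho // oppr0 mulr0.
by rewrite big_ord1 wedgeNr; exact: wedgeC.
Qed.

Lemma chr_form_neq0 i x v : dom i x -> dfun h i x v <> 0 -> chr_form i x v <> 0.
Proof.
move=> dx dh0 /(Ad_eq0 (null_rotation_unit G_sym G_unit e_null ef x)) w0; apply: dh0.
have := congr1 (mulmx^~ e) w0; rewrite mul0mx wedge_mul oe.
by rewrite (ipC G_sym (dfun h i x v)) dhe // scale0r scaleN1r sub0r opprK.
Qed.

Lemma isothermic_chr_form (L : S -> {vspace 'cV[R]_n.+2}) eta :
  eq_form eta chr_form -> (forall x, L x = <[point x]>%VS) ->
  (forall i x, dom i x -> injective (dfun f i x)) ->
  closed_1form chr_form ->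
  (exists i x v, dom i x /\ dfun h i x v <> 0) -> isothermic G L eta.
Proof.
move=> etaE LE inj closed [i0 [x0 [v0 [dx0 dh0]]]]; split.
- split; first exact: (@cone_lift_bundle R S n G G_sym e o e_null o_null oe f f_smooth).
  exact: (@cone_lift_immersion R S n G G_sym G_unit e o e_null oe f f_smooth).
- split; first exact: smooth_1form_eq etaE chr_form_smooth.
  move=> i x v w dx; rewrite (dform_near v w dx etaE chr_form_smooth).
  exact: closed.
- by exists i0, x0, v0; split=> //; rewrite etaE //; exact: chr_form_neq0.
by move=> i x v dx; rewrite etaE //; exact: chr_form_values.
Qed.

End Christoffel_form.

(** * The dual conserved quantity *)

(** The coefficient of degree k of t p(t). *)
Definition prev_coef {R : realType} {S : smoothSurface R} {n : nat}
    (p : nat -> S -> 'cV[R]_n.+2) (k : nat) : S -> 'cV[R]_n.+2 :=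
  if k is k'.+1 then p k' else fun=> 0.

Section Dual_quantity.
Context {R : realType} {S : smoothSurface R} {n : nat} (G : 'M[R]_n.+2).
Hypotheses (G_sym : G^T = G) (G_unit : G \in unitmx).
Variables (e o : 'cV[R]_n.+2).
Hypotheses (e_null : ip G e e = 0) (o_null : ip G o o = 0) (oe : ip G o e = -1).
Variables f h : S -> 'cV[R]_n.+2.
Hypotheses (f_smooth : smooth f) (h_smooth : smooth h).
Hypotheses (ef : forall x, ip G e (f x) = 0) (of_ : forall x, ip G o (f x) = 0).
Hypotheses (eh : forall x, ip G e (h x) = 0) (oh : forall x, ip G o (h x) = 0).
Implicit Types (i : chart S) (x : S) (v w : 'rV[R]_2) (u : 'cV[R]_n.+2).
Local Notation point := (cone_lift G e o f).
Local Notation pointc := (cone_lift G o e h).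

Let eo : ip G e o = -1. Proof. by rewrite ipC. Qed.

(** [wpart x u] and [bpart x u] are the middle component and the coefficient of
    [e] of exp(-f ^ e) u in the decomposition <o> + {e, o}^perp + <e>; the
    coefficient of [o] is - (u, e). *)
Definition wpart x u := u + ip G u e *: (o + f x) + ip G u o *: e.
Definition bpart x u := - ip G u (point x).

Lemma wpart_linear x c u u' :
  wpart x (c *: u + u') = c *: wpart x u + wpart x u'.
Proof. by rewrite /wpart !ipE; apply/matrixP => i j; rewrite !mxE; ring. Qed.

Lemma wpart0 x : wpart x 0 = 0.
Proof. by rewrite /wpart !ip0l !scale0r !addr0. Qed.

Lemma bpart0 x : bpart x 0 = 0.
Proof. by rewrite /bpart ip0l oppr0. Qed.

Lemma wpart_e x u : ip G (wpart x u) e = 0.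
Proof. by rewrite /wpart !ipE e_null oe (ipC G_sym (f x)) ef; ring. Qed.

Lemma wpart_o x u : ip G (wpart x u) o = 0.
Proof. by rewrite /wpart !ipE o_null eo (ipC G_sym (f x)) of_; ring. Qed.

Lemma wpart_of_e x c : wpart x (c *: e) = 0.
Proof.
by rewrite /wpart !ipE e_null eo; apply/matrixP => i j; rewrite !mxE; ring.
Qed.

Lemma ip_rot x u u' : ip G e u = 0 -> ip G o u = 0 ->
  ip G (u + ip G (f x) u *: e) u' = ip G u (wpart x u').
Proof.
move=> eu ou; rewrite /wpart !ipE (ipC G_sym u e) (ipC G_sym u o) eu ou.
by rewrite (ipC G_sym u' e) (ipC G_sym u (f x)); ring.
Qed.

Lemma bpartE x u :
  bpart x u = - (ip G u o + ip G u (f x) + ip G (f x) (f x) / 2 * ip G u e).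
Proof. by rewrite /bpart (cone_liftE G_sym) // !ipE. Qed.

(** The rotation is an isometry, so (u, u) = (w, w) - 2 a b with a = - (u, e) the
    coefficient of [o] and b that of [e].  Only the product a b enters, which is
    why multiplying b by t and dividing a by t preserves the norm. *)
Lemma norm_split x u :
  ip G u u = ip G (wpart x u) (wpart x u) + 2 * (bpart x u * ip G u e).
Proof.
rewrite bpartE /wpart !ipE e_null o_null eo oe ef of_.
rewrite ![ip G e u](ipC G_sym) ![ip G o u](ipC G_sym) ![ip G (f x) u](ipC G_sym).
by rewrite ![ip G (f x) e](ipC G_sym) ![ip G (f x) o](ipC G_sym) ef of_; field.
Qed.

Lemma split_eq0 x u : ip G u e = 0 -> wpart x u = 0 -> bpart x u = 0 -> u = 0.
Proof.
rewrite bpartE /wpart => ue; rewrite ue scale0r addr0 mulr0 addr0.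
move=> /eqP; rewrite addr_eq0 => /eqP uE.
have -> : ip G u (f x) = 0 by rewrite uE !ipE ef mulr0 oppr0.
by rewrite addr0 => /eqP; rewrite oppr_eq0 => /eqP uo; rewrite uE uo scale0r oppr0.
Qed.

Variable p : nat -> S -> 'cV[R]_n.+2.
Hypothesis p_smooth : forall k i, smooth_in i (p k).
Hypothesis p_parallel : forall k i x v, dom i x ->
  dfun (p k) i x v = - (chr_form G e o f h i x v *m prev_coef p k x).

(** The coefficient of degree k of exp(h ^ o) Gamma(t) exp(-f ^ e) p(t), where
    Gamma(t) multiplies the [e]-component by t and divides the [o]-component
    by t: hence the opposite shifts of degree in the first and last terms. *)
Definition dual_coef k x :=
  - ip G (p k.+1 x) e *: o
  + (wpart x (p k x) + ip G (h x) (wpart x (p k x)) *: o)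
  + bpart x (prev_coef p k x) *: pointc x.

Let f_in i : smooth_in i f := (smoothP f).1 f_smooth i.
Let h_in i : smooth_in i h := (smoothP h).1 h_smooth i.

Lemma smooth_in_prev k i : smooth_in i (prev_coef p k).
Proof. by case: k => [|k] /=; [exact: smooth_in_cst|exact: p_smooth]. Qed.

Lemma smooth_in_wpart i (g : S -> 'cV[R]_n.+2) :
  smooth_in i g -> smooth_in i (fun z => wpart z (g z)).
Proof.
move=> C1; have Ce := smooth_in_cst i e; have Co := smooth_in_cst i o.
have C3 := smooth_in_scale (smooth_in_ip G C1 Ce) (smooth_in_add Co (f_in i)).
have C4 := smooth_in_scale (smooth_in_ip G C1 Co) Ce.
exact: smooth_in_add (smooth_in_add C1 C3) C4.
Qed.

Lemma smooth_in_bpart i (g : S -> 'cV[R]_n.+2) :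
  smooth_in i g -> smooth_in i (fun z => bpart z (g z)).
Proof.
move=> C1; have C2 := smooth_in_cone_lift G_sym e_null oe f_smooth ef of_ i.
exact: smooth_in_opp (smooth_in_ip G C1 C2).
Qed.

Section At_a_point.
Variables (i : chart S) (x : S) (v : 'rV[R]_2) (dx : dom i x).
Let D (V : normedModType R) (g : S -> V) := @smooth_in_diff R S V i x g dx.

Let dh := dfun h i x v.
Let df := dfun f i x v.
Let Y := dh + ip G (f x) dh *: e.
Let edh : ip G e dh = 0. Proof. exact: dfun_orth. Qed.
Let odh : ip G o dh = 0. Proof. exact: dfun_orth. Qed.
Let edf : ip G e df = 0. Proof. exact: dfun_orth. Qed.
Let odf : ip G o df = 0. Proof. exact: dfun_orth. Qed.

(** The parallel equation with the rank-two form written out: the derivative of a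
    coefficient is a combination of the lift and of its rotated tangent
    direction. *)
Lemma dcoef k : dfun (p k) i x v =
  - (ip G dh (wpart x (prev_coef p k x)) *: point x) - bpart x (prev_coef p k x) *: Y.
Proof.
rewrite p_parallel // (chr_formE G_sym G_unit) // wedge_mul -/dh -/Y.
by rewrite /Y ip_rot // opprB [LHS]addrC /bpart scaleNr opprK (ipC G_sym (point x)).
Qed.

Let Ye : ip G Y e = 0.
Proof. by rewrite /Y !ipE e_null (ipC G_sym dh) edh; ring. Qed.

Let Yo : ip G Y o = - ip G (f x) dh.
Proof. by rewrite /Y !ipE eo (ipC G_sym dh) odh; ring. Qed.

Let Ypoint : ip G Y (point x) = 0.
Proof.
rewrite /Y (cone_liftE G_sym) // !ipE eo (ipC G_sym dh o) (ipC G_sym dh e) edh odh.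
by rewrite ef e_null (ipC G_sym dh); ring.
Qed.

Lemma dcoef_e k : ip G (dfun (p k) i x v) e = ip G dh (wpart x (prev_coef p k x)).
Proof.
by rewrite dcoef ipDl 2!ipNl 2!ipZl Ye (cone_lift_e G_sym) //; ring.
Qed.

Lemma dcoef_o k : ip G (dfun (p k) i x v) o =
    ip G dh (wpart x (prev_coef p k x)) * (ip G (f x) (f x) / 2)
    + bpart x (prev_coef p k x) * ip G (f x) dh.
Proof.
rewrite dcoef ipDl 2!ipNl 2!ipZl Yo.
rewrite (cone_liftE G_sym) // ipDl ipDl ipZl o_null eo (ipC G_sym (f x) o) of_.
by field.
Qed.

Lemma dcoef_point k : ip G (dfun (p k) i x v) (point x) = 0.
Proof.
by rewrite dcoef ipDl 2!ipNl 2!ipZl Ypoint (cone_lift_null G_sym) //; ring.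
Qed.

(** The middle equation d w_k = - a_k df - b_(k-1) dh.  It is invariant under the
    exchange of (f, a_k) with (h, b_(k-1)), and it carries the whole
    computation of the degree. *)
Lemma dfun_wpart k : dfun (fun z => wpart z (p k z)) i x v =
  - bpart x (prev_coef p k x) *: dh + ip G (p k x) e *: df.
Proof.
have C1 := p_smooth k i; have Ce := smooth_in_cst i e; have Co := smooth_in_cst i o.
have C2 := smooth_in_add Co (f_in i).
have C3 := smooth_in_ip G C1 Ce; have C4 := smooth_in_ip G C1 Co.
have C5 := smooth_in_scale C3 C2; have C6 := smooth_in_scale C4 Ce.
rewrite (dfun_add v (D (smooth_in_add C1 C5)) (D C6)) (dfun_add v (D C1) (D C5)).
rewrite (dfun_scale v dx (D C3) (D C2)) (dfun_scale v dx (D C4) (D Ce)).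
rewrite (dfun_add v (D Co) (D (f_in i))).
rewrite (dfun_ip G v dx (D C1) (D Ce)) (dfun_ip G v dx (D C1) (D Co)).
rewrite !dfun_cst !ip0r scaler0 !addr0 add0r.
move: (dcoef_e k) (dcoef_o k) (dcoef k); set dk := dfun (p k) i x v.
move: dk => dk dke dko dkE; rewrite dke dko dkE.
have alg (c b q ff fd : R) (dh' df' o' f' e' : 'cV[R]_n.+2) :
    - (c *: (o' + f' + (ff / 2) *: e')) - b *: (dh' + fd *: e')
      + (c *: (o' + f') + q *: df') + (c * (ff / 2) + b * fd) *: e'
    = - b *: dh' + q *: df'.
  by apply/matrixP => j k'; rewrite !mxE; ring.
by rewrite (cone_liftE G_sym) //; exact: alg.
Qed.

Let dprev_point k : ip G (dfun (prev_coef p k) i x v) (point x) = 0.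
Proof. by case: k => [|k]; [rewrite dfun_cst ip0l|exact: dcoef_point]. Qed.

Lemma dfun_bpart k : dfun (fun z => bpart z (prev_coef p k z)) i x v =
  - ip G df (wpart x (prev_coef p k x)).
Proof.
have C1 := smooth_in_prev k i.
have C2 := smooth_in_cone_lift G_sym e_null oe f_smooth ef of_ i.
rewrite (dfun_opp v dx (smooth_in_ip G C1 C2)); congr (- _).
apply: (etrans (dfun_ip G v dx (D C1) (D C2))).
apply: (etrans (congr1 (fun a => a + _) (dprev_point k))); rewrite add0r.
rewrite (dfun_cone_lift G_sym) // (null_rotation_perp G_sym) // ipC //.
exact: ip_rot.
Qed.

Lemma dfun_dual k : dfun (dual_coef k) i x v =
  ip G (p k x) e *: (df + ip G (h x) df *: o)
  - ip G df (wpart x (prev_coef p k x)) *: pointc x.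
Proof.
have Ce := smooth_in_cst i e; have Co := smooth_in_cst i o.
have Ca := smooth_in_opp (smooth_in_ip G (p_smooth k.+1 i) Ce).
have CW := smooth_in_wpart (p_smooth k i).
have ChW := smooth_in_ip G (h_in i) CW.
have Cb : smooth_in i (fun z => bpart z (prev_coef p k z)).
  exact: smooth_in_bpart (smooth_in_prev k i).
have Cpc := smooth_in_cone_lift G_sym o_null eo h_smooth oh eh i.
have E1 : dfun (fun z => - ip G (p k.+1 z) e) i x v =
    - ip G dh (wpart x (p k x)).
  apply: (etrans (dfun_opp v dx (smooth_in_ip G (p_smooth k.+1 i) Ce))).
  congr (- _); apply: (etrans (dfun_ip G v dx (D (p_smooth k.+1 i)) (D Ce))).
  by rewrite dfun_cst ip0r addr0; exact: dcoef_e.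
have ip_comb u a c r s : ip G u (r *: a + s *: c) = r * ip G u a + s * ip G u c.
  by rewrite ipDr !ipZr.
have E2 : dfun (fun z => ip G (h z) (wpart z (p k z))) i x v =
    ip G dh (wpart x (p k x))
    + (- bpart x (prev_coef p k x) * ip G (h x) dh + ip G (p k x) e * ip G (h x) df).
  apply: (etrans (dfun_ip G v dx (D (h_in i)) (D CW))).
  apply: (etrans (congr1 (fun a => _ + ip G _ a) (dfun_wpart k))).
  exact: (congr1 (fun a => _ + a) (ip_comb _ _ _ _ _)).
have E3 : dfun pointc i x v = dh + ip G (h x) dh *: o.
  apply: (etrans (dfun_cone_lift G_sym o_null eo h_smooth oh eh v dx)).
  exact: (null_rotation_perp G_sym o_null oh x odh).
have C1 := smooth_in_scale Ca Co; have C2 := smooth_in_scale ChW Co.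
have C3 := smooth_in_add CW C2; have C4 := smooth_in_scale Cb Cpc.
rewrite (dfun_add v (D (smooth_in_add C1 C3)) (D C4)) (dfun_add v (D C1) (D C3)).
rewrite (dfun_add v (D CW) (D C2)) (dfun_scale v dx (D Ca) (D Co)).
rewrite (dfun_scale v dx (D ChW) (D Co)) (dfun_scale v dx (D Cb) (D Cpc)).
have alg (A H B c b q hd hf g a hW : R) (DO DW DP dh' df' o' pc : 'cV[R]_n.+2) :
    A = - c -> DO = 0 -> DW = - b *: dh' + q *: df' ->
    H = c + (- b * hd + q * hf) -> B = - g -> DP = dh' + hd *: o' ->
    A *: o' + a *: DO + (DW + (H *: o' + hW *: DO)) + (B *: pc + b *: DP) =
    q *: (df' + hf *: o') - g *: pc.
  move=> -> -> -> -> -> ->.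
  by apply/matrixP => j k'; rewrite !mxE; ring.
exact: alg E1 (dfun_cst i x v o) (dfun_wpart k) E2 (dfun_bpart k) E3.
Qed.

End At_a_point.

(** The definition of the dual coefficient as a rotated vector, which reduces inner
    products with it to the fixed decomposition at [o] and [e]. *)
Lemma dual_rot k x : dual_coef k x = null_rotation G o h x *m
  (- ip G (p k.+1 x) e *: o + wpart x (p k x) + bpart x (prev_coef p k x) *: e).
Proof.
rewrite 2!mulmxDr -2!scalemxAr (null_rotation_e G_sym o_null oh).
have oW : ip G o (wpart x (p k x)) = 0 by rewrite ipC // wpart_o.
by rewrite (null_rotation_perp G_sym o_null oh x oW).
Qed.

Lemma ip_pointc_dual k x : ip G (pointc x) (dual_coef k x) = ip G (p k.+1 x) e.
Proof.
rewrite dual_rot (null_rotation_isometry G_sym o_null oh).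
by rewrite ipDr ipDr 2!ipZr (ipC G_sym e (wpart _ _)) wpart_e e_null eo; ring.
Qed.

Lemma ip_rotc_dual k x u : ip G e u = 0 -> ip G o u = 0 ->
  ip G (u + ip G (h x) u *: o) (dual_coef k x) = ip G u (wpart x (p k x)).
Proof.
move=> eu ou; rewrite -(null_rotation_perp G_sym o_null oh) // dual_rot.
rewrite (null_rotation_isometry G_sym o_null oh) ipDr ipDr 2!ipZr.
by rewrite (ipC G_sym u o) (ipC G_sym u e) eu ou; ring.
Qed.

Hypothesis p0_e : forall x, ip G (p 0 x) e = 0.

(** For k = 0 the left-hand side is - a_0 times a tangent direction, since nothing
    of degree -1 contributes: this is where the constant term has to be orthogonal
    to [e]. *)
Lemma dual_parallel k i x v : dom i x ->
  dfun (dual_coef k) i x v = - (chr_form G o e h f i x v *m prev_coef dual_coef k x).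
Proof.
move=> dx; rewrite dfun_dual //.
case: k => [|k]; first by rewrite mulmx0 p0_e wpart0 ip0r !scale0r subr0 oppr0.
rewrite (chr_formE G_sym G_unit) // wedge_mul ip_pointc_dual.
have edf : ip G e (dfun f i x v) = 0 by exact: dfun_orth.
have odf : ip G o (dfun f i x v) = 0 by exact: dfun_orth.
by rewrite (ip_rotc_dual k x edf odf) opprB.
Qed.

Lemma smooth_in_dual k i : smooth_in i (dual_coef k).
Proof.
have Ce := smooth_in_cst i e; have Co := smooth_in_cst i o.
have Ca := smooth_in_opp (smooth_in_ip G (p_smooth k.+1 i) Ce).
have CW := smooth_in_wpart (p_smooth k i).
have ChW := smooth_in_ip G (h_in i) CW.
have Cb := smooth_in_bpart (smooth_in_prev k i).
have Cpc := smooth_in_cone_lift G_sym o_null eo h_smooth oh eh i.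
have C1 := smooth_in_scale Ca Co; have C2 := smooth_in_scale ChW Co.
exact: smooth_in_add (smooth_in_add C1 (smooth_in_add CW C2)) (smooth_in_scale Cb Cpc).
Qed.

Lemma dual0_o x : ip G o (dual_coef 0 x) = 0.
Proof.
rewrite /dual_coef /= bpart0 scale0r addr0 ipDr ipDr 2!ipZr o_null.
by rewrite (ipC G_sym o) wpart_o; ring.
Qed.

Lemma dual0_line x c : p 0 x = c *: e -> dual_coef 0 x = - ip G (p 1 x) e *: o.
Proof.
move=> p0E; rewrite /dual_coef /= bpart0 scale0r addr0.
by rewrite p0E wpart_of_e ip0r scale0r !addr0.
Qed.

Lemma dual_eq0 k x :
  p k x = 0 -> p k.+1 x = 0 -> bpart x (prev_coef p k x) = 0 -> dual_coef k x = 0.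
Proof.
move=> pk pk1 b0; rewrite /dual_coef pk pk1 b0 wpart0 ip0r ip0l oppr0 !scale0r.
by rewrite !addr0.
Qed.

Lemma dual_eq0_parts k x : p k.+1 x = 0 -> dual_coef k x = 0 ->
  wpart x (p k x) = 0 /\ bpart x (prev_coef p k x) = 0.
Proof.
move=> pk1; rewrite dual_rot pk1 ip0l oppr0 scale0r add0r => r0.
have {r0} s0 : wpart x (p k x) + bpart x (prev_coef p k x) *: e = 0.
  apply: (can_inj (mulKmx (null_rotation_unit G_sym G_unit o_null oh x))).
  by rewrite r0 mulmx0.
have b0 : bpart x (prev_coef p k x) = 0.
  have := congr1 (ip G ^~ o) s0; rewrite /= ip0l ipDl ipZl wpart_o eo.
  by lra.
by split=> //; move: s0; rewrite b0 scale0r addr0.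
Qed.

(** When the middle component of degree k vanishes identically, so does its
    derivative, and the middle equation becomes a relation between dh and df. *)
Lemma wpart_vanish k i x v : (forall x, wpart x (p k x) = 0) -> dom i x ->
  bpart x (prev_coef p k x) *: dfun h i x v = ip G (p k x) e *: dfun f i x v.
Proof.
move=> w0 dx; have := dfun_wpart v dx k.
have -> : (fun z => wpart z (p k z)) = fun=> 0 by apply/funext.
rewrite dfun_cst scaleNr => /esym/eqP; rewrite addrC subr_eq0 => /eqP.
by move=> ->.
Qed.

(** The dual polynomial is, up to an isometry, A o + w + t b e with t A = a; the
    product of the outer coefficients is thus still a b. *)
Lemma dual_norm N t x : (forall k, (N <= k)%N -> p k x = 0) ->
  let P := \sum_(k < N) t ^+ k *: p k x in
  let Q := \sum_(k < N.+1) t ^+ k *: dual_coef k x in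
  ip G Q Q = ip G P P.
Proof.
move=> pN P Q.
have ip_sum m (c : nat -> R) (u : nat -> 'cV[R]_n.+2) a :
    ip G (\sum_(k < m) c k *: u k) a = \sum_(k < m) c k * ip G (u k) a.
  elim: m => [|m IH]; first by rewrite !big_ord0 ip0l.
  by rewrite !big_ord_recr /= ipDl ipZl IH.
have wpart_sum m (c : nat -> R) (u : nat -> 'cV[R]_n.+2) :
    wpart x (\sum_(k < m) c k *: u k) = \sum_(k < m) c k *: wpart x (u k).
  elim: m => [|m IH]; first by rewrite !big_ord0 wpart0.
  by rewrite !big_ord_recr /= addrC wpart_linear IH addrC.
have ipP a : ip G P a = \sum_(k < N) t ^+ k * ip G (p k x) a.
  exact: (ip_sum N (fun k => t ^+ k) (fun k => p k x)).
have wpartP : wpart x P = \sum_(k < N) t ^+ k *: wpart x (p k x).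
  exact: (wpart_sum N (fun k => t ^+ k) (fun k => p k x)).
pose A := \sum_(k < N.+1) t ^+ k * - ip G (p k.+1 x) e.
have tA : t * A = - ip G P e.
  have T1 : \sum_(k < N.+1) - (t ^+ k * ip G (p k x) e) = - ip G P e.
    by rewrite big_ord_recr /= pN // ip0l mulr0 oppr0 addr0 sumrN -ipP.
  rewrite -T1 big_ord_recl /= p0_e mulr0 oppr0 add0r /A big_ord_recr /=.
  rewrite pN // ip0l oppr0 mulr0 addr0 mulr_sumr.
  by apply: eq_bigr => k _; rewrite /bump /= add1n exprS; ring.
pose Z := A *: o + wpart x P + (t * bpart x P) *: e.
have QZ : Q = null_rotation G o h x *m Z.
  have wP : wpart x P = \sum_(k < N.+1) t ^+ k *: wpart x (p k x).
    by rewrite big_ord_recr /= pN // wpart0 scaler0 addr0 wpartP.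
  have bP : t * bpart x P = \sum_(k < N.+1) t ^+ k * bpart x (prev_coef p k x).
    rewrite big_ord_recl /= bpart0 mulr0 add0r /bpart ipP -sumrN mulr_sumr.
    by apply: eq_bigr => k _; rewrite exprS -mulrN mulrA.
  rewrite /Z wP bP /A !scaler_suml -!big_split mulmx_sumr.
  by apply: eq_bigr => k _; rewrite dual_rot scalemxAr !scalerDr !scalerA.
rewrite QZ (null_rotation_isometry G_sym o_null oh) (norm_split x P).
move: (wpart_e x P) (wpart_o x P) tA; rewrite /Z.
move: (wpart x P) (bpart x P) (ip G P e) => W B q We Wo tA.
have eW : ip G e W = 0 by rewrite ipC.
have oW : ip G o W = 0 by rewrite ipC.
rewrite !ipE We Wo eW oW e_null o_null eo oe.
have -> : q = - (t * A) by rewrite tA opprK.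
by ring.
Qed.

Hypothesis h_inj : forall i x v, dom i x -> dfun h i x v = 0 -> v = 0.
Hypothesis f_inj : forall i x v, dom i x -> dfun f i x v = 0 -> v = 0.

Let dir : 'rV[R]_2 := delta_mx 0 0.
Let dir_neq0 : dir <> 0.
Proof. by move/matrixP/(_ 0 0)/eqP; rewrite !mxE oner_eq0. Qed.

(** The middle equation in degree d + 1 reads b_d dh = 0, so b_d = 0 because [h] is
    immersed: the upward shift of the [e]-component does not raise the degree.
    Conversely, if the dual coefficient of degree d vanished, then so would w_d and
    b_(d-1); the middle equation in degree d would give a_d df = 0, hence a_d = 0,
    and with b_d = 0 the original coefficient would vanish. *)
Lemma dual_degree d :
  (exists x, p d x <> 0) -> (forall k, (d < k)%N -> forall x, p k x = 0) ->
  (exists x, dual_coef d x <> 0) /\ (forall k, (d < k)%N -> forall x, dual_coef k x = 0).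
Proof.
move=> [x0 pd0] pk0.
have bd x : bpart x (p d x) = 0.
  have [i dx] := @dom_cover _ S x.
  have w0 z : wpart z (p d.+1 z) = 0 by rewrite pk0 // wpart0.
  have /eqP := wpart_vanish dir w0 dx.
  rewrite pk0 // ip0l scale0r scaler_eq0 => /orP[/eqP//|/eqP dh0].
  by have := dir_neq0; rewrite (h_inj dx dh0).
split; last first.
  case=> // k dk x; apply: dual_eq0; [exact: pk0|exact: pk0 (ltnW _) _|].
  move: dk; rewrite ltnS leq_eqVlt => /orP[/eqP <-|dk] /=; first exact: bd.
  by rewrite pk0 // /bpart ip0l oppr0.
apply: contrapT => nq; have q0 x : dual_coef d x = 0.
  by apply: contrapT => qx; apply: nq; exists x.
have parts x := dual_eq0_parts (pk0 _ (ltnSn d) x) (q0 x).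
apply: pd0; have [i dx] := @dom_cover _ S x0.
have /eqP := wpart_vanish dir (fun x => (parts x).1) dx.
rewrite (parts x0).2 scale0r eq_sym scaler_eq0 => /orP[/eqP pe|/eqP df0].
  exact: (split_eq0 pe (parts x0).1 (bd x0)).
by have := dir_neq0; rewrite (f_inj dx df0).
Qed.

End Dual_quantity.

(** * Polynomials in t and the Christoffel transform *)

(** Entrywise, a polynomial of degree less than N with the N roots
    0, 1, ..., N - 1. *)
Lemma polynomial_vanish (R : realType) (m N : nat) (c : nat -> 'cV[R]_m) :
  (forall t : R, \sum_(k < N) t ^+ k *: c k = 0) ->
  forall k, (k < N)%N -> c k = 0.
Proof.
move=> c0 k kN; apply/matrixP => i j; rewrite mxE.
pose P := \poly_(k < N) c k i j.
have P0 : P = 0.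
  apply: (@roots_geq_poly_eq0 _ _ [seq a%:R | a <- iota 0 N]).
  - apply/allP => _ /mapP[a _ ->]; rewrite rootE horner_poly.
    have := congr1 (fun M : 'cV[R]_m => M i j) (c0 a%:R).
    rewrite summxE mxE => s0; apply/eqP; rewrite -[RHS]s0.
    by apply: eq_bigr => l _; rewrite mxE mulrC.
  - by rewrite map_inj_uniq ?iota_uniq //; exact: mulrIn (oner_neq0 R).
  - by rewrite size_map size_iota; exact: size_poly.
by have := coef_poly N (fun k => c k i j) k; rewrite -/P P0 coef0 kN.
Qed.

Section Polynomial_sections.
Context {R : realType} {S : smoothSurface R} {n : nat}.
Implicit Types (i : chart S) (x : S) (v : 'rV[R]_2).

Lemma dfun_sum N (c : nat -> R) (g : nat -> S -> 'cV[R]_n.+2) i x v :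
  dom i x -> (forall k, smooth_in i (g k)) ->
  smooth_in i (fun z => \sum_(k < N) c k *: g k z) /\
  dfun (fun z => \sum_(k < N) c k *: g k z) i x v =
  \sum_(k < N) c k *: dfun (g k) i x v.
Proof.
move=> dx sg; have D := smooth_in_diff dx.
elim: N => [|N [IHs IHd]].
  have -> : (fun z => \sum_(k < 0) c k *: g k z) = fun=> 0.
    by apply/funext => z; rewrite big_ord0.
  by rewrite big_ord0 dfun_cst; split=> //; exact: smooth_in_cst.
have -> : (fun z => \sum_(k < N.+1) c k *: g k z) =
    fun z => \sum_(k < N) c k *: g k z + c N *: g N z.
  by apply/funext => z; rewrite big_ord_recr.
have C := smooth_in_scale (smooth_in_cst i (c N)) (sg N).
split; first exact: smooth_in_add.
rewrite big_ord_recr /= -IHd.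
apply: (etrans (dfun_add v (D _ _ IHs) (D _ _ C))); congr (_ + _).
apply: (etrans (dfun_scale v dx (D _ _ (smooth_in_cst i (c N))) (D _ _ (sg N)))).
by rewrite dfun_cst scale0r add0r.
Qed.

(** Collecting the powers of t.  The sum has one term more than [p], since the form
    enters multiplied by t. *)
Lemma conserved_defect (p : polysec S n) (M : 'M[R]_n.+2) t i x v : dom i x ->
  (forall k, smooth_in i (pcoef p k)) ->
  dfun (peval p t) i x v + t *: (M *m peval p t x) =
  \sum_(k < (size p).+1) t ^+ k *:
     (dfun (pcoef p k) i x v + M *m prev_coef (pcoef p) k x).
Proof.
move=> dx sp; under [RHS]eq_bigr => k _ do rewrite scalerDr.
rewrite big_split /=; congr (_ + _).
  rewrite big_ord_recr /=.
  have -> : pcoef p (size p) = fun=> 0 by rewrite /pcoef nth_default.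
  rewrite dfun_cst scaler0 addr0.
  exact: (dfun_sum (size p) (fun k => t ^+ k) v dx sp).2.
rewrite big_ord_recl /= mulmx0 scaler0 add0r /peval mulmx_sumr scaler_sumr.
by apply: eq_bigr => k _; rewrite -scalemxAr scalerA -exprS.
Qed.

Lemma conserved_coefficients (eta : vform S 'M[R]_n.+2) (p : polysec S n) :
  (forall k i, smooth_in i (pcoef p k)) ->
  (forall t i x v, dom i x ->
     dfun (peval p t) i x v + t *: (eta i x v *m peval p t x) = 0) <->
  (forall k i x v, dom i x ->
     dfun (pcoef p k) i x v = - (eta i x v *m prev_coef (pcoef p) k x)).
Proof.
move=> sp; split=> [cons k i x v dx|coef t i x v dx]; last first.
  rewrite conserved_defect //; apply: big1 => k _.
  by rewrite coef // addNr scaler0.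
have [kN|Nk] := ltnP k (size p).+1.
  apply/eqP; rewrite -addr_eq0; apply/eqP.
  apply: (@polynomial_vanish _ _ (size p).+1
    (fun k => dfun (pcoef p k) i x v + eta i x v *m prev_coef (pcoef p) k x)) kN => t.
  by rewrite -conserved_defect // cons.
have pk m : (size p <= m)%N -> pcoef p m = fun=> 0.
  by move=> pm; rewrite /pcoef nth_default.
case: k Nk => [//|k Nk]; rewrite [prev_coef _ _]/= (pk k.+1 (leqW Nk)) (pk k Nk) dfun_cst.
by rewrite mulmx0 oppr0.
Qed.

Lemma peval0 (p : polysec S n) x : peval p 0 x = pcoef p 0 x.
Proof.
rewrite /peval; case: p => [|a p] /=; first by rewrite big_ord0.
rewrite big_ord_recl expr0 scale1r big1 ?addr0 // => k _.
by rewrite expr0n scale0r.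
Qed.

End Polynomial_sections.

Theorem theorem3p8 (R : realType) (n : nat) (n_ge3 : (3 <= n)%N)
  (S : smoothSurface R) (S_connected : connected [set: S])
  (G : 'M[R]_n.+2) (G_lorentzian : lorentzian G)
  (vinf v0 : 'cV[R]_n.+2)
  (vinf_null : lightcone G vinf) (v0_null : lightcone G v0)
  (v0vinf : ip G v0 vinf = -1)
  (L Lc : S -> {vspace 'cV[R]_n.+2}) (eta etac : vform S 'M[R]_n.+2)
  (L_isothermic : isothermic G L eta)
  (L_christoffel : christoffel_transform G vinf v0 L eta Lc etac)
  (d : nat) (p : polysec S n)
  (L_special : special_isothermic G L eta d p)
  (p0_orth : forall x, orth G [set` <[vinf]>%VS] (peval p 0 x)) :
  exists q : polysec S n,
    [/\ special_isothermic G Lc etac d q,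
        forall t x, ip G (peval q t x) (peval q t x)
                    = ip G (peval p t x) (peval p t x),
        forall x, orth G [set` <[v0]>%VS] (peval q 0 x)
      & (forall x, peval p 0 x \in <[vinf]>%VS) ->
        (forall x, peval q 0 x \in <[v0]>%VS)].
Proof.
have [G_sym G_unit] := lorentzian_sym G_lorentzian.
have [[_ vinf2] [_ v02]] := (vinf_null, v0_null).
have vinfv0 : ip G vinf v0 = -1 by rewrite ipC.
(* The vectors e, o of the sections above are vinf, v0 for the given surface, and
   v0, vinf for its transform. *)
have [f [fc [[f_smooth f_perp] [[fc_smooth fc_inj] fc_perp] [LE etaE] LcE etacE]]] :=
  L_christoffel.
have perp (g : S -> 'cV[R]_n.+2) :
    (forall x, orth G [set` <<[:: v0; vinf]>>%VS] (g x)) ->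
    (forall x, ip G v0 (g x) = 0) /\ (forall x, ip G vinf (g x) = 0).
  by move=> gP; split=> x; apply: gP => /=; apply: memv_span; rewrite !inE eqxx ?orbT.
have [of_ ef] := perp f f_perp; have [oh eh] := perp fc fc_perp.
have [[_ L_imm] [eta_smooth eta_closed] [i0 [x0 [v1 [dx0 _]]]] _] := L_isothermic.
have f_inj i x v : dom i x -> dfun f i x v = 0 -> v = 0.
  exact: (immersion_of_cone_lift G_sym vinf2 v0vinf f_smooth ef of_ LE L_imm).
have h_inj i x v : dom i x -> dfun fc i x v = 0 -> v = 0.
  by move=> dx fcv; apply: (fc_inj i x dx); rewrite fcv /dfun linear0.
have etaE' : eq_form (chr_form G vinf v0 f fc) eta.
  by move=> i x v dx; rewrite etaE.
have closed : closed_1form (chr_form G vinf v0 f fc).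
  by move=> i x v w dx; rewrite (dform_near v w dx etaE' eta_smooth); exact: eta_closed.
have closed_c : closed_1form (chr_form G v0 vinf fc f).
  have sym := (closed_chr_formP G_sym G_unit vinf2 v0vinf f_smooth fc_smooth
    ef of_ eh).1 closed.
  apply: (closed_chr_formP G_sym G_unit v02 vinfv0 fc_smooth f_smooth
    oh eh of_).2 => i x v w dx.
  have [s1 s2] := sym i x v w dx; split.
    exact: (etrans (ipC G_sym _ _) (etrans (esym s1) (ipC G_sym _ _))).
  exact: (etrans (wedgeC _ _ _) (etrans (congr1 -%R (esym s2)) (esym (wedgeC _ _ _)))).
have Lc_isothermic : isothermic G Lc etac.
  apply: (isothermic_chr_form G_sym G_unit v02 vinf2 vinfv0 fc_smooth f_smooth
    oh eh of_ ef etacE LcE fc_inj closed_c).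
  exists i0, x0, (delta_mx 0 0); split=> // /(f_inj _ _ _ dx0)/matrixP/(_ 0 0)/eqP.
  by rewrite !mxE oner_eq0.
have [_ [_ p_smooth p_cons] [p_top p_deg]] := L_special.
have p_in k i : smooth_in i (pcoef p k) by have /smoothP := p_smooth k.
have p_par k i x v : dom i x ->
    dfun (pcoef p k) i x v = - (chr_form G vinf v0 f fc i x v *m prev_coef (pcoef p) k x).
  move=> dx; rewrite etaE' //.
  by apply: (conserved_coefficients eta p_in).1 => //; exact: p_cons.
have p0_e x : ip G (pcoef p 0 x) vinf = 0.
  by rewrite ipC // -peval0; apply: p0_orth; exact: memv_line.
pose dp := dual_coef G vinf v0 f fc (pcoef p).
(* One degree beyond p is kept, because of the upward shift of the component
   along vinf. *)
pose q : polysec S n := mkseq dp (size p).+1.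
have p_big m x : (size p <= m)%N -> pcoef p m x = 0.
  by move=> pm; rewrite /pcoef nth_default.
have qE k : pcoef q k = dp k.
  have [kN|Nk] := ltnP k (size p).+1; first by rewrite /pcoef nth_mkseq.
  rewrite /pcoef nth_default ?size_mkseq //; apply/funext => x; apply/esym.
  apply: dual_eq0; rewrite ?p_big //; try exact: ltnW; try by rewrite ltnW // ltnW.
  by case: k Nk => // k Nk /=; rewrite p_big // bpart0.
have q_in k i : smooth_in i (pcoef q k) by rewrite qE; exact: smooth_in_dual.
have [q_top q_deg] : has_degree q d.
  have [[x dpx] dpk] := dual_degree G_sym G_unit vinf2 v02 v0vinf f_smooth fc_smooth
    ef of_ eh oh p_in p_par h_inj f_inj p_top p_deg.
  by split=> [|k dk z]; [exists x; rewrite qE|rewrite qE; exact: dpk].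
exists q; split=> [|t x|x|p0_line x].
- split=> //; split=> [|k|].
  + by have [x qx] := q_top; exists d, x.
  + by apply/smoothP => i; exact: q_in.
  move=> t; apply: (conserved_coefficients etac q_in).2 => k i x v dx.
  rewrite qE etacE //.
  have -> : prev_coef (pcoef q) k x = prev_coef dp k x by case: k => //= k; rewrite qE.
  exact: dual_parallel.
- rewrite /peval size_mkseq.
  under eq_bigr do rewrite qE.
  exact: (dual_norm G_sym vinf2 v02 v0vinf ef of_ oh p0_e t (fun k => @p_big k x)).
- move=> _ /vlineP[c ->]; rewrite peval0 qE ipZl.
  by rewrite (dual0_o G_sym v02 v0vinf fc of_) mulr0.
have /vlineP[c] := p0_line x; rewrite !peval0 qE => p0c.
by rewrite /dp (dual0_line G_sym vinf2 v0vinf f fc p0c) memvZ // memv_line.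
Qed.
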